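(* Let $\mathfrak g$ be an affine Lie algebra with Weyl group $W=T\rtimes\overset{\circ}{W}$, let $\Lambda$ be a dominant integral weight of level $k>0$, let $N$ be the set of maximal dominant weights in $P(\Lambda)$, and let $\bar N$ be a set of $T$-class representatives of the set $\tilde N=\overset{\circ}{W}\cdot N$. For $b=(b_0,\dots,b_\ell)\in\mathbb Z^{\ell+1}$ let $\eta=\eta(b)=\Lambda-\sum_{i=0}^\ell b_i\alpha_i$, and let $\zeta$ be the unique element of $\bar N$ such that $\tilde\eta=\tilde\zeta$. Let $\alpha\in M$ be determined by the formula $\eta=t_\alpha(\zeta)-s(\eta)\delta$, where $s(\eta)\in\mathbb Z$ is the $\delta$-shift of $\eta$. (1) Writing $\eta-\zeta=c_0\alpha_0+\dots+c_\ell\alpha_\ell$, we have $$\alpha=\frac{1}{ka_0}\big((a_0c_1-a_1c_0)\alpha_1+\dots+(a_0c_\ell-a_\ell c_0)\alpha_\ell\big),$$ and $$s(\eta)=-\frac{c_0}{a_0}-\left((\zeta|\alpha)+\tfrac12(\alpha|\alpha)k\right).$$ (2) $\eta$ lies in $P(\Lambda)$ if and only if $s(\eta)\geq 0$.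
   Context: $\mathfrak g$ is the affine Kac--Moody algebra over $\mathbb C$ with $(\ell+1)\times(\ell+1)$ affine Cartan matrix $A=[a_{ij}]_{0\le i,j\le\ell}$, $\mathfrak h$ its Cartan subalgebra (of dimension $\ell+2$), with simple roots $\alpha_0,\dots,\alpha_\ell\in\mathfrak h^*$ and simple coroots $h_0,\dots,h_\ell\in\mathfrak h$, $\langle h_i,\alpha_j\rangle=a_{ij}$. Kac's numbering of nodes is used, i.e. the matrices are as follows ($a_{ii}=2$; each listed pair $\{i,j\}$ gives $a_{ij}=a_{ji}=-1$ except for the stated exceptions; all other off-diagonal entries are $0$; ''chain'' means the pairs $\{i,i+1\}$, $0\le i\le \ell-1$): $A^{(1)}_1$: $a_{01}=a_{10}=-2$. $A^{(1)}_\ell$ ($\ell\ge2$): chain and $\{\ell,0\}$. $B^{(1)}_\ell$ ($\ell\ge3$): $\{0,2\}$, $\{i,i+1\}$ for $1\le i\le\ell-1$, except $a_{\ell,\ell-1}=-2$. $C^{(1)}_\ell$ ($\ell\ge2$): chain, except $a_{1,0}=-2$, $a_{\ell-1,\ell}=-2$. $D^{(1)}_\ell$ ($\ell\ge4$): $\{0,2\}$, $\{i,i+1\}$ for $1\le i\le\ell-2$, $\{\ell-2,\ell\}$. $D^{(2)}_{\ell+1}$ ($\ell\ge2$): chain, except $a_{0,1}=-2$, $a_{\ell,\ell-1}=-2$. $A^{(2)}_{2\ell-1}$ ($\ell\ge3$): $\{0,2\}$, $\{i,i+1\}$ for $1\le i\le\ell-1$, except $a_{\ell-1,\ell}=-2$.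 $A^{(2)}_2$: $a_{01}=-4$, $a_{10}=-1$. $A^{(2)}_{2\ell}$ ($\ell\ge2$): chain, except $a_{0,1}=-2$, $a_{\ell-1,\ell}=-2$. $E^{(1)}_6$: $\{1,2\},\{2,3\},\{3,4\},\{4,5\},\{3,6\},\{6,0\}$. $E^{(1)}_7$: $\{i,i+1\}$ for $0\le i\le5$, and $\{3,7\}$. $E^{(1)}_8$: $\{i,i+1\}$ for $0\le i\le 6$, and $\{5,8\}$. $F^{(1)}_4$: chain ($\ell=4$), except $a_{32}=-2$. $E^{(2)}_6$: chain ($\ell=4$), except $a_{23}=-2$. $G^{(1)}_2$: chain ($\ell=2$), except $a_{21}=-3$. $D^{(3)}_4$: chain ($\ell=2$), except $a_{12}=-3$. Types with superscript $(1)$ are untwisted, the others twisted. The null root is $\delta=\sum_i a_i\alpha_i$, where $(a_0,\dots,a_\ell)$ are the coprime positive integers with $\sum_j a_{ij}a_j=0$ for all $i$; the canonical central element is $c=\sum_i a_i^\vee h_i$, where $(a_0^\vee,\dots,a_\ell^\vee)$ are the coprime positive integers with $\sum_i a_i^\vee a_{ij}=0$ for all $j$. The invariant symmetric bilinear form $(\cdot|\cdot)$ on $\mathfrak h^*$ satisfies $(\alpha_i|\eta)=\frac{a_i^\vee}{a_i}\langle h_i,\eta\rangle$ for all $\eta\in\mathfrak h^*$; in particular $(\alpha_i|\alpha_j)=\frac{a_i^\vee}{a_i}a_{ij}$ and $(\alpha_i|\delta)=(\delta|\delta)=0$. $Q=\sum_i\mathbb Z\alpha_i$, $Q_+=\sum_i\mathbb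 Z_{\ge0}\alpha_i$. A weight $\eta\in\mathfrak h^*$ is dominant integral if $\langle h_i,\eta\rangle\in\mathbb Z_{\ge0}$ for all $i$. The level of $\eta$ is $\langle c,\eta\rangle$. For $\Lambda$ dominant integral, $P(\Lambda)\subseteq\Lambda-Q_+$ is the set of weights of the irreducible integrable highest-weight module $L(\Lambda)$. A weight $\eta\in P(\Lambda)$ is maximal if $\eta+\delta\notin P(\Lambda)$; $\max(\Lambda)$ is the set of maximal weights. $W$ is the group generated by $s_i:\eta\mapsto\eta-\langle h_i,\eta\rangle\alpha_i$, $0\le i\le\ell$, acting on $\mathfrak h^*$; $\overset{\circ}{W}$ is the subgroup generated by $s_1,\dots,s_\ell$. The lattice $M\subset\mathfrak h^*$ has $\mathbb Z$-basis $\frac{d_1\alpha_1}{a_0},\dots,\frac{d_\ell\alpha_\ell}{a_0}$, where $d_i=a_0a_i/a_i^\vee$ if $\mathfrak g$ is untwisted or of type $A^{(2)}_{2\ell}$, and $d_i=1$ for all $i$ in the other twisted types (all $d_i$ are positive integers). $T=\{t_\alpha\mid\alpha\in M\}$ is the abelian normal subgroup of $W$ with $t_\alpha(\eta)=\eta+m\alpha-\left((\eta|\alpha)+\tfrac12(\alpha|\alpha)m\right)\delta$, where $m=\langle c,\eta\rangle$; one has $W=T\rtimes\overset{\circ}{W}$. $\delta$-shift: for $\eta\in\Lambda-Q$, $s(\eta)$ is the largest integer $s$ with $\eta+s\delta\in P(\Lambda)$ (it exists when the level $k$ of $\Lambda$ is positive). For $\eta=\eta(b)=\Lambda-\sum_i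 b_i\alpha_i$, put $\tilde\eta=\big((a_0b_1-a_1b_0)\bmod kd_1,\dots,(a_0b_\ell-a_\ell b_0)\bmod kd_\ell\big)\in\prod_{i=1}^\ell(\mathbb Z/kd_i\mathbb Z)$. $N$ is the set of dominant elements of $\max(\Lambda)$; $\tilde N=\overset{\circ}{W}\cdot N$ is the union of the $\overset{\circ}{W}$-orbits of its elements. Two elements of $\tilde N$ are in the same $T$-class if an element of $T$ maps one to the other; $\bar N\subseteq\tilde N$ contains exactly one element of each $T$-class. *)

(* Defs.v *)
From HB Require Import structures.
From mathcomp Require Import all_boot all_order all_algebra.
From mathcomp Require Import boolp classical_sets reals.
From mathcomp Require Import complex.

Set Implicit Arguments.
Unset Strict Implicit.
Unset Printing Implicit Defensive.

Import Order.TTheory GRing.Theory Num.Theory.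
Local Open Scope classical_set_scope.
Local Open Scope ring_scope.

(* In the names, the last letter is the tier: A1 is A^(1), A2 is A^(2), and
   so on. The argument is l in the infinite families, in particular D2 l is
   D_{l+1}^(2), A2odd l is A_{2l-1}^(2) and A2even l is A_{2l}^(2). *)
Inductive affine_type : Type :=
  | A1 of nat | B1 of nat | C1 of nat | D1 of nat
  | D2 of nat | A2odd of nat | A2even of nat
  | E6_1 | E7_1 | E8_1 | F4_1 | E6_2 | G2_1 | D4_3.

Definition valid_type (t : affine_type) : bool :=
  match t with
  | A1 l => (1 <= l)%N
  | B1 l => (3 <= l)%N
  | C1 l => (2 <= l)%N
  | D1 l => (4 <= l)%N
  | D2 l => (2 <= l)%N
  | A2odd l => (3 <= l)%N
  | A2even l => (1 <= l)%N
  | _ => true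
  end.

Definition rank (t : affine_type) : nat :=
  match t with
  | A1 l | B1 l | C1 l | D1 l | D2 l | A2odd l | A2even l => l
  | E6_1 => 6
  | E7_1 => 7
  | E8_1 => 8
  | F4_1 | E6_2 => 4
  | G2_1 | D4_3 => 2
  end.

Definition untwisted (t : affine_type) : bool :=
  match t with
  | D2 _ | A2odd _ | A2even _ | E6_2 | D4_3 => false
  | _ => true
  end.

Definition is_A2even (t : affine_type) : bool :=
  if t is A2even _ then true else false.

(* [path_edges m n] lists the pairs {i, i+1} for m <= i <= n-1. *)
Definition path_edges (m n : nat) : seq (nat * nat) :=
  [seq (i, i.+1) | i <- iota m (n - m)].

Definition edges (t : affine_type) : seq (nat * nat) :=
  match t with
  | A1 l => if l == 1%N then [:: (0, 1)]%N else (l, 0)%N :: path_edges 0 l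
  | B1 l | A2odd l => (0, 2)%N :: path_edges 1 l
  | D1 l => [:: (0, 2), (l - 2, l) & path_edges 1 (l - 1)]%N
  | E6_1 => [:: (1, 2); (2, 3); (3, 4); (4, 5); (3, 6); (6, 0)]%N
  | E7_1 => (3, 7)%N :: path_edges 0 6
  | E8_1 => (5, 8)%N :: path_edges 0 7
  | C1 _ | D2 _ | A2even _ | F4_1 | E6_2 | G2_1 | D4_3 =>
      path_edges 0 (rank t)
  end.

(* Off-diagonal entries other than 0 and -1: ((i, j), a_ij). *)
Definition exceptions (t : affine_type) : seq ((nat * nat) * int) :=
  match t with
  | A1 l => if l == 1%N then [:: ((0, 1)%N, -2); ((1, 0)%N, -2)] else [::]
  | B1 l => [:: ((l, (l - 1)%N), -2)]
  | C1 l => [:: ((1, 0)%N, -2); (((l - 1)%N, l), -2)]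
  | D2 l => [:: ((0, 1)%N, -2); ((l, (l - 1)%N), -2)]
  | A2odd l => [:: (((l - 1)%N, l), -2)]
  | A2even l => if l == 1%N then [:: ((0, 1)%N, -4)]
                else [:: ((0, 1)%N, -2); (((l - 1)%N, l), -2)]
  | F4_1 => [:: ((3, 2)%N, -2)]
  | E6_2 => [:: ((2, 3)%N, -2)]
  | G2_1 => [:: ((2, 1)%N, -3)]
  | D4_3 => [:: ((1, 2)%N, -3)]
  | D1 _ | E6_1 | E7_1 | E8_1 => [::]
  end.

Definition cartan_entry (t : affine_type) (i j : nat) : int :=
  if i == j then 2
  else if [seq x.2 | x <- exceptions t & x.1 == (i, j)] is z :: _ then z
  else if ((i, j) \in edges t) || ((j, i) \in edges t) then -1
  else 0.

Definition cartan_matrix (t : affine_type) : 'M[int]_((rank t).+1) :=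
  \matrix_(i, j) cartan_entry t i j.

Definition is_marks (n : nat) (A : 'M[int]_n) (a : 'I_n -> nat) : Prop :=
  [/\ forall i, (0 < a i)%N,
      (\big[gcdn/0]_(i < n) a i)%N = 1%N
    & forall i, \sum_(j < n) A i j * (a j)%:Z = 0].

(* A realization of the affine Cartan matrix, its (co)marks, and a symmetric
   bilinear form on the dual of the Cartan subalgebra. The last axiom fixes
   the form on every pair having a member in the span of the roots, and
   implies invariance under the Weyl group; only such pairs are ever used. *)
Record affine_datum (C : fieldType) (t : affine_type) : Type := AffineDatum {
  cartan_sub : vectType C;
  simple_coroot : 'I_(rank t).+1 -> cartan_sub;
  simple_root : 'I_(rank t).+1 -> 'Hom(cartan_sub, C^o);
  dim_cartan_sub : \dim {: cartan_sub} = (rank t).+2;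
  simple_coroot_free : free [tuple simple_coroot i | i < (rank t).+1];
  simple_root_free : free [tuple simple_root i | i < (rank t).+1];
  pairing_entry : forall i j, simple_root j (simple_coroot i) = (cartan_matrix t i j)%:~R;
  mark : 'I_(rank t).+1 -> nat;
  comark : 'I_(rank t).+1 -> nat;
  markP : is_marks (cartan_matrix t) mark;
  comarkP : is_marks (cartan_matrix t)^T comark;
  inv_form : 'Hom(cartan_sub, C^o) -> 'Hom(cartan_sub, C^o) -> C;
  inv_formC : forall x y, inv_form x y = inv_form y x;
  inv_form_scalar : forall x, scalar (inv_form x);
  inv_form_root : forall i x,
    inv_form (simple_root i) x = (comark i)%:R / (mark i)%:R * x (simple_coroot i)
}.

Definition weight (C : fieldType) (t : affine_type) (X : affine_datum C t) :=
  'Hom(cartan_sub X, C^o).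

Record lie_algebra (C : fieldType) : Type := LieAlgebra {
  lie_sort :> lmodType C;
  bracket : lie_sort -> lie_sort -> lie_sort;
  bracket_linearl : forall y, linear (bracket ^~ y);
  bracket_linearr : forall x, linear (bracket x);
  bracketxx : forall x, bracket x x = 0;
  jacobi : forall x y z,
    bracket x (bracket y z) + bracket y (bracket z x)
      + bracket z (bracket x y) = 0
}.

Record lie_module (C : fieldType) (g : lie_algebra C) : Type := LieModule {
  mod_sort :> lmodType C;
  mod_act : g -> mod_sort -> mod_sort;
  act_linearl : forall v, linear (mod_act ^~ v);
  act_linearr : forall x, linear (mod_act x);
  act_bracket : forall x y v,
    mod_act (bracket x y) v = mod_act x (mod_act y v) - mod_act y (mod_act x v)
}.

Definition is_subspace (C : fieldType) (V : lmodType C) (S : set V) : Prop :=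
  S 0 /\ forall (c : C) (u v : V), S u -> S v -> S (c *: u + v).

Definition is_subalgebra (C : fieldType) (g : lie_algebra C) (S : set g) :=
  is_subspace S /\ forall x y, S x -> S y -> S (bracket x y).

Definition is_ideal (C : fieldType) (g : lie_algebra C) (S : set g) :=
  is_subspace S /\ forall x y, S y -> S (bracket x y).

Definition is_submodule (C : fieldType) (g : lie_algebra C)
    (V : lie_module g) (S : set V) : Prop :=
  is_subspace S /\ forall x v, S v -> S (mod_act x v).

Definition is_irreducible (C : fieldType) (g : lie_algebra C)
    (V : lie_module g) : Prop :=
  (exists v : V, v != 0) /\
  forall S : set V, is_submodule S ->
    (forall v, S v -> v = 0) \/ (forall v, S v).

(* Kac, Infinite dimensional Lie algebras, Proposition 1.4: up to isomorphism
   g(A) is the only Lie algebra with these properties. *)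
Record kac_moody (C : fieldType) (t : affine_type) (X : affine_datum C t) :
    Type := KacMoody {
  km_algebra :> lie_algebra C;
  km_h : cartan_sub X -> km_algebra;
  km_e : 'I_(rank t).+1 -> km_algebra;
  km_f : 'I_(rank t).+1 -> km_algebra;
  km_h_linear : linear km_h;
  km_h_inj : injective km_h;
  km_hh : forall x y, bracket (km_h x) (km_h y) = 0;
  km_he : forall x i, bracket (km_h x) (km_e i) = simple_root X i x *: km_e i;
  km_hf : forall x i, bracket (km_h x) (km_f i) = - (simple_root X i x *: km_f i);
  km_ef : forall i j,
    bracket (km_e i) (km_f j) = if i == j then km_h (simple_coroot X i) else 0;
  km_generated : forall S : set km_algebra, is_subalgebra S ->
    (forall x, S (km_h x)) -> (forall i, S (km_e i)) ->
    (forall i, S (km_f i)) -> forall x, S x;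
  km_ideal : forall I : set km_algebra, is_ideal I ->
    (forall x, I (km_h x) -> x = 0) -> forall x, I x -> x = 0
}.

Definition dominant_integral (C : fieldType) (t : affine_type)
    (X : affine_datum C t) (eta : weight X) : Prop :=
  forall i, exists n : nat, eta (simple_coroot X i) = n%:R.

(* The value at the canonical central element. *)
Definition level (C : fieldType) (t : affine_type) (X : affine_datum C t)
    (eta : weight X) : C :=
  eta (\sum_i simple_coroot X i *+ comark X i).

Definition null_root (C : fieldType) (t : affine_type) (X : affine_datum C t)
    : weight X :=
  \sum_i simple_root X i *+ mark X i.
Arguments null_root {C t} X.

Definition has_weight_vector (C : fieldType) (t : affine_type)
    (X : affine_datum C t) (g : kac_moody X) (V : lie_module g)
    (mu : weight X) (v : V) : Prop :=
  v != 0 /\ forall x, mod_act (km_h g x) v = mu x *: v.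

(* V is the module L(Lam): an irreducible module which is generated by any of
   its nonzero vectors, one of them being a highest-weight vector. *)
Definition is_irr_highest_weight (C : fieldType) (t : affine_type)
    (X : affine_datum C t) (g : kac_moody X) (V : lie_module g)
    (Lam : weight X) : Prop :=
  is_irreducible V /\
  exists v : V, has_weight_vector Lam v /\ forall i, mod_act (km_e g i) v = 0.

Definition weights (C : fieldType) (t : affine_type) (X : affine_datum C t)
    (g : kac_moody X) (V : lie_module g) : set (weight X) :=
  [set mu | exists v : V, has_weight_vector mu v].

Definition maximal_weights (C : fieldType) (t : affine_type)
    (X : affine_datum C t) (P : set (weight X)) : set (weight X) :=
  [set eta | P eta /\ ~ P (eta + null_root X)].

Definition is_delta_shift (C : fieldType) (t : affine_type)
    (X : affine_datum C t) (P : set (weight X)) (eta : weight X) (s : int) :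
    Prop :=
  P (eta + null_root X *~ s) /\
  forall s' : int, P (eta + null_root X *~ s') -> s' <= s.

Definition reflection (C : fieldType) (t : affine_type)
    (X : affine_datum C t) (i : 'I_(rank t).+1) (eta : weight X) : weight X :=
  eta - eta (simple_coroot X i) *: simple_root X i.

(* The group generated by s_1, ..., s_l: words suffice, since the generators
   are involutions. *)
Definition finite_weyl (C : fieldType) (t : affine_type)
    (X : affine_datum C t) : set (weight X -> weight X) :=
  [set w | exists s : seq 'I_(rank t),
     w = foldr (fun i f => reflection (lift ord0 i) \o f) id s].
Arguments finite_weyl {C t} X.

(* d_i for the node i + 1, with i < l; the quotient is exact. *)
Definition dcoef (C : fieldType) (t : affine_type) (X : affine_datum C t)
    (i : 'I_(rank t)) : nat :=
  if untwisted t || is_A2even t then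
    (mark X ord0 * mark X (lift ord0 i) %/ comark X (lift ord0 i))%N
  else 1%N.
Arguments dcoef {C t} X i.

Definition lattice_M (C : fieldType) (t : affine_type) (X : affine_datum C t)
    : set (weight X) :=
  [set alpha | exists z : 'I_(rank t) -> int,
     alpha = \sum_i
       (((dcoef X i)%:R / (mark X ord0)%:R) *: simple_root X (lift ord0 i)) *~ z i].
Arguments lattice_M {C t} X.

Definition translation (C : fieldType) (t : affine_type)
    (X : affine_datum C t) (alpha eta : weight X) : weight X :=
  eta + level eta *: alpha
    - (inv_form eta alpha + inv_form alpha alpha * level eta / 2) *: null_root X.

Definition translations (C : fieldType) (t : affine_type)
    (X : affine_datum C t) : set (weight X -> weight X) :=
  [set translation alpha | alpha in lattice_M X].
Arguments translations {C t} X.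

Definition same_class (C : fieldType) (t : affine_type)
    (X : affine_datum C t) (mu nu : weight X) : Prop :=
  exists2 tau, translations X tau & nu = tau mu.

Definition max_dominant (C : fieldType) (t : affine_type)
    (X : affine_datum C t) (P : set (weight X)) : set (weight X) :=
  [set eta | maximal_weights P eta /\ dominant_integral eta].

Definition max_dominant_orbits (C : fieldType) (t : affine_type)
    (X : affine_datum C t) (P : set (weight X)) : set (weight X) :=
  [set mu | exists w nu,
     [/\ finite_weyl X w, max_dominant P nu & mu = w nu]].

Definition is_class_representatives (C : fieldType) (t : affine_type)
    (X : affine_datum C t) (S Sbar : set (weight X)) : Prop :=
  Sbar `<=` S /\
  forall mu, S mu -> exists! zeta, Sbar zeta /\ same_class mu zeta.

Definition eta_of (C : fieldType) (t : affine_type) (X : affine_datum C t)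
    (Lam : weight X) (b : 'I_(rank t).+1 -> int) : weight X :=
  Lam - \sum_i simple_root X i *~ b i.

(* Entry i represents a class of Z/(k d_i)Z by its canonical remainder; the
   types 'Z_n are not used because k d_i can be 1. *)
Definition residues (C : fieldType) (t : affine_type) (X : affine_datum C t)
    (k : nat) (b : 'I_(rank t).+1 -> int) : {ffun 'I_(rank t) -> int} :=
  [ffun i => (((mark X ord0)%:Z * b (lift ord0 i)
                - (mark X (lift ord0 i))%:Z * b ord0)
              %% (k * dcoef X i)%N%:Z)%Z].
Arguments residues {C t} X k b.

(* b and b' are determined by eta and zeta, the simple roots being linearly
   independent. *)
Definition same_residues (C : fieldType) (t : affine_type)
    (X : affine_datum C t) (Lam : weight X) (k : nat) (eta zeta : weight X) :
    Prop :=
  exists b b', [/\ eta = eta_of Lam b, zeta = eta_of Lam b'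
                 & residues X k b = residues X k b'].

(* Main.v *)
(* Write P for the set of weights, theta = delta - a_0 alpha_0, and W_f for the
   finite Weyl group.

   P is invariant under W because the e_i and f_i act locally nilpotently (the
   Serre relations hold since an element of n_- killed by all e_i generates an
   ideal that meets the Cartan subalgebra trivially), so sl_2-theory gives full
   root strings. The form is positive semidefinite with kernel spanned by delta.
   Hence, first, a dominant element of Lam - Q_+ is a weight, and second, every
   element of Lam - Q is W-conjugate to a dominant one: replacing eta by s_i eta
   when eta is negative on h_i preserves the norm and cannot go on forever, since
   the level is positive. So P is closed under subtracting delta, and the
   delta-shift exists.

   For each affine type theta is conjugate to a simple root under W_f and the
   W_f-orbit of theta / a_0 spans M; with s_0 = t_{theta / a_0} s_theta this
   gives W = T W_f with T contained in W. Thus every maximal weight is a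
   T-translate of an element of W_f N. Finally
   eta - zeta = k alpha + (c_0 / a_0) delta, where k alpha has coefficients
   (a_0 c_i - a_i c_0) / a_0, and alpha lies in M exactly when the integers
   a_0 c_i - a_i c_0 are divisible by k d_i, which is equality of residues. *)

Require Import Defs.
From mathcomp Require Import all_boot all_order all_algebra.
From mathcomp Require Import boolp classical_sets reals.
From mathcomp Require Import complex.
From mathcomp Require Import zify ring lra.
Set Implicit Arguments.
Unset Strict Implicit.
Unset Printing Implicit Defensive.
Import Order.TTheory GRing.Theory Num.Theory.
Local Open Scope ring_scope.

(** * Submodules generated by singular vectors *)

(** The algebra is known only through its generators and the absence of ideals that meet the Cartan
    subalgebra trivially; neither Serre relations nor root spaces are at hand. Everything about it
    is drawn from one construction, the span of the words in the [f_i] applied to a vector killed by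
    all [e_i]: in the adjoint module it yields the Serre relations, in L(Lam) the integrability. Nor
    are the labels given: marks and comarks are any coprime positive solutions, to be identified
    with tables before a type can be examined. This and the finiteness arguments rest on one
    positivity statement. It is made over the rationals in the coordinates b_i / a_i, where the null
    root is the constant vector and the form is the Laplacian of a connected weighted graph, so that
    semidefiniteness and the kernel are treated for all types at once. Case analysis by type is left
    for the tables, the connectedness of the diagram, the path from a simple root to theta and the
    generation of M. The multiple of delta between eta and a translate of zeta is a priori no
    integer; its integrality comes from a node of mark one. *)

Section LinearSpan.
Variables (C : fieldType) (V : lmodType C).

Inductive lin_span (G : set V) : V -> Prop :=
  | span_nil : lin_span G 0
  | span_cons c x u : G x -> lin_span G u -> lin_span G (c *: x + u).

Lemma span_gen (G : set V) x : G x -> lin_span G x.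
Proof.
by move=> Gx; rewrite -[x]addr0 -[x]scale1r; apply: span_cons => //; apply: span_nil.
Qed.

Lemma span_subspace (G : set V) : is_subspace (lin_span G).
Proof.
split; first exact: span_nil.
move=> c u v Su Sv; elim: Su => [|d x w Gx _ IH]; first by rewrite scaler0 add0r.
by rewrite scalerDr scalerA -addrA; apply: span_cons.
Qed.

Lemma span_least (G S : set V) :
  is_subspace S -> (forall x, G x -> S x) -> forall u, lin_span G u -> S u.
Proof. by move=> [S0 SD] GS u; elim=> // c x w Gx _ IH; apply: SD => //; apply: GS. Qed.

End LinearSpan.

Section Subspace.
Variables (C : fieldType) (V : lmodType C) (S : set V).
Hypothesis S_sub : is_subspace S.

Lemma subspaceD u v : S u -> S v -> S (u + v).
Proof. by case: S_sub => _ SD Su Sv; rewrite -[u]scale1r; apply: SD. Qed.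

Lemma subspaceZ c u : S u -> S (c *: u).
Proof. by case: S_sub => S0 SD Su; rewrite -[_ *: _]addr0; apply: SD. Qed.

Lemma subspaceB u v : S u -> S v -> S (u - v).
Proof. by move=> Su Sv; apply: subspaceD => //; rewrite -scaleN1r; apply: subspaceZ. Qed.

End Subspace.

Section LinearFacts.
Variables (C : fieldType) (U V : lmodType C) (f : U -> V).
Hypothesis f_lin : linear f.

Lemma lin0 : f 0 = 0.
Proof.
by have := f_lin (-1) 0 0; rewrite scaler0 addr0 scaleN1r addNr.
Qed.

Lemma linD u v : f (u + v) = f u + f v.
Proof. by have := f_lin 1 u v; rewrite !scale1r. Qed.

Lemma linZ c u : f (c *: u) = c *: f u.
Proof. by have := f_lin c u 0; rewrite lin0 !addr0. Qed.

Lemma linN u : f (- u) = - f u.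
Proof. by rewrite -scaleN1r linZ scaleN1r. Qed.

End LinearFacts.

Lemma iter_lin (C : fieldType) (V : lmodType C) (f : V -> V) (n : nat) :
  linear f -> linear (iter n f).
Proof. by move=> fl; elim: n => [|n IH] c u v //=; rewrite IH fl. Qed.

Lemma comp_preim_subspace (C : fieldType) (U V : lmodType C) (f : U -> V) (S : set V) :
  linear f -> is_subspace S -> is_subspace (fun u => S (f u)).
Proof.
move=> fl [S0 SD]; split; first by rewrite lin0.
by move=> c u v Su Sv; rewrite fl; apply: SD.
Qed.

(** * Strings in representations of sl_2 *)

Section Sl2.
Variables (C : numFieldType) (V : lmodType C) (E F H : V -> V).
Hypotheses (E_lin : linear E) (F_lin : linear F).
Hypothesis EF : forall v, E (F v) = F (E v) + H v.
Hypothesis HF : forall v, H (F v) = F (H v) - 2 *: F v.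
Hypothesis HE : forall v, H (E v) = E (H v) + 2 *: E v.

Lemma sl2_weightF (u : V) (lam : C) q : H u = lam *: u ->
  H (iter q F u) = (lam - 2 * q%:R) *: iter q F u.
Proof.
move=> Hu; elim: q => [|q IH]; first by rewrite mulr0 subr0.
rewrite iterS HF IH (linZ F_lin) -scalerBl; congr (_ *: _).
by rewrite -natr1; ring.
Qed.

Lemma sl2_weightE (u : V) (lam : C) q : H u = lam *: u ->
  H (iter q E u) = (lam + 2 * q%:R) *: iter q E u.
Proof.
move=> Hu; elim: q => [|q IH]; first by rewrite mulr0 addr0.
rewrite iterS HE IH (linZ E_lin) -scalerDl; congr (_ *: _).
by rewrite -natr1; ring.
Qed.

Lemma sl2_raise (u : V) (lam : C) q : E u = 0 -> H u = lam *: u ->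
  E (iter q.+1 F u) = (q.+1%:R * (lam - q%:R)) *: iter q F u.
Proof.
move=> Eu Hu; elim: q => [|q IH].
  by rewrite /= EF Eu (lin0 F_lin) add0r Hu subr0 mul1r.
rewrite iterS EF IH (linZ F_lin) (sl2_weightF _ Hu) -scalerDl; congr (_ *: _).
by rewrite -!natr1; ring.
Qed.

Lemma first_iter_zero (G : V -> V) (u : V) : u != 0 -> (exists N, iter N G u = 0) ->
  exists2 q, iter q G u != 0 & iter q.+1 G u = 0.
Proof.
move=> u0 [N /eqP HN].
have ex : exists N, iter N G u == 0 by exists N.
case: (ex_minnP ex) => [[|q]] Hq Hmin; first by rewrite /= (negPf u0) in Hq.
exists q; last exact/eqP.
by apply/negP => /Hmin; rewrite ltnn.
Qed.

(* [iter p E u] is the last nonzero vector on the way up from [u]; its weight is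
   the number of nonzero steps down from it. *)
Lemma sl2_string (u : V) (m : int) (j : nat) : u != 0 -> H u = m%:~R *: u ->
    (forall w, exists N, iter N E w = 0) -> (forall w, exists N, iter N F w = 0) ->
    (j%:Z <= m) ->
  exists p, iter (p + j) F (iter p E u) != 0.
Proof.
move=> u0 Hu Enil Fnil jm.
have [p p0 p1] := first_iter_zero u0 (Enil u).
have [q q0 q1] := first_iter_zero p0 (Fnil (iter p E u)).
exists p; have Hw := sl2_weightE p Hu.
have := sl2_raise q p1 Hw; rewrite q1 (lin0 E_lin) => /esym/eqP.
rewrite scaler_eq0 (negPf q0) orbF mulf_eq0 pnatr_eq0 /= subr_eq0 => /eqP E1.
have {E1} E2 : m + 2 * p%:Z = q%:Z.
  by apply/eqP; rewrite -(@eqr_int C) intrD intrM; apply/eqP.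
have le : (p + j <= q)%N by lia.
apply/eqP => z; move: q0; rewrite -(subnK le) iterD z.
by rewrite (lin0 (iter_lin _ F_lin)) eqxx.
Qed.

End Sl2.

(** * Weight vectors and words in the f_i *)

Section Module.
Variables (C : numFieldType) (t : affine_type) (X : affine_datum C t) (g : kac_moody X).
Notation I := 'I_(rank t).+1.
Notation al := (simple_root X).

(** Elements of Q_+ are written as words in the nodes, up to order, so that one word describes both
    a product of the [f_i] and the weight it subtracts. *)
Definition root_sum (s : seq I) : weight X := \sum_(i <- s) al i.

Definition is_wvec (M : lie_module g) (mu : weight X) (v : M) : Prop :=
  forall x, mod_act (km_h g x) v = mu x *: v.

Section Generic.
Variable M : lie_module g.
Local Notation act := (@mod_act C g M).

Lemma act_linr x : linear (act x). Proof. exact: act_linearr. Qed.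
Lemma act_linl v : linear (act ^~ v). Proof. exact: act_linearl. Qed.

Lemma act_comm x y v : act x (act y v) = act y (act x v) + act (bracket x y) v.
Proof. by rewrite act_bracket addrC subrK. Qed.

Lemma act_e_f i j v : act (km_e g i) (act (km_f g j) v) =
  act (km_f g j) (act (km_e g i) v)
    + (if i == j then act (km_h g (simple_coroot X i)) v else 0).
Proof.
rewrite act_comm km_ef; congr (_ + _); case: eqP => // _.
exact: (lin0 (act_linl v)).
Qed.

Lemma wvec_f mu v i : is_wvec mu v -> is_wvec (mu - al i) (act (km_f g i) v).
Proof.
move=> w x; rewrite act_comm km_hf w (linZ (act_linr _)).
rewrite (linN (act_linl v)) (linZ (act_linl v)) -scalerBl.
by rewrite !lfunE /= !lfunE.
Qed.

Lemma wvec_e mu v i : is_wvec mu v -> is_wvec (mu + al i) (act (km_e g i) v).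
Proof.
move=> w x; rewrite act_comm km_he w (linZ (act_linr _)).
by rewrite (linZ (act_linl v)) -scalerDl !lfunE.
Qed.

Lemma wvec_e_iter mu v i n : is_wvec mu v ->
  is_wvec (mu + al i *+ n) (iter n (act (km_e g i)) v).
Proof.
move=> w; elim: n => [|n IH]; first by rewrite addr0.
by rewrite mulrSr addrA iterS; apply: wvec_e.
Qed.

Lemma wvec_f_iter mu v i n : is_wvec mu v ->
  is_wvec (mu - al i *+ n) (iter n (act (km_f g i)) v).
Proof.
move=> w; elim: n => [|n IH]; first by rewrite subr0.
by rewrite mulrSr opprD addrA iterS; apply: wvec_f.
Qed.

(* Apply [h - p.1 h] for an element [h] of the Cartan subalgebra separating the
   weight [p.1] of one summand from [nu]. *)
Lemma wvec_indep (r : seq (weight X * M)) nu u :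
  is_wvec nu u -> u = \sum_(p <- r) p.2 ->
  (forall p, p \in r -> is_wvec p.1 p.2 /\ p.1 != nu) -> u = 0.
Proof.
have [n] := ubnP (size r); elim: n r u => // n IH [|p r] u sz wu.
  by rewrite big_nil.
rewrite big_cons => Eu Hr.
have [wp pnu] := Hr p (mem_head _ _).
have Hr' q (qr : q \in r) : is_wvec q.1 q.2 /\ q.1 != nu.
  by apply: Hr; rewrite inE qr orbT.
have [x Hx] : exists x, p.1 x != nu x.
  apply/not_existsP => H; move/eqP: pnu; apply; apply/lfunP => x.
  by have := H x; move/negP; rewrite negbK => /eqP.
have d0 : nu x - p.1 x != 0 by rewrite subr_eq0 eq_sym.
suff : (nu x - p.1 x) *: u = 0.
  by move/eqP; rewrite scaler_eq0 (negPf d0) => /eqP.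
apply: (IH [seq (q.1, (q.1 x - p.1 x) *: q.2) | q : weight X * M <- r]).
- by rewrite size_map; move: sz => /=; lia.
- move=> y; rewrite (linZ (act_linr _)) wu !scalerA mulrC; congr (_ *: _).
- rewrite big_map scalerBl -wu {1}Eu (linD (act_linr _)) wp {1}Eu scalerDr.
  rewrite opprD addrACA subrr add0r scaler_sumr.
  have -> : act (km_h g x) (\sum_(j <- r) j.2) = \sum_(j <- r) j.1 x *: j.2.
    have {}Hr : forall q, q \in r -> is_wvec q.1 q.2.
      by move=> q qr; have [] := Hr' q qr.
    elim: (r) Hr => [|q r' IHr] Hr; first by rewrite !big_nil (lin0 (act_linr _)).
    rewrite !big_cons (linD (act_linr _)) Hr ?mem_head // IHr // => q' q'r.
    by apply: Hr; rewrite inE q'r orbT.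
  by rewrite -sumrB; apply: eq_bigr => q _; rewrite scalerBl.
- move=> q /mapP [q' q'r ->] /=; have [wq qn] := Hr' q' q'r.
  by split=> // y; rewrite (linZ (act_linr _)) wq !scalerA mulrC.
Qed.

Definition f_word (w : M) (s : seq I) : M := foldr (fun i => act (km_f g i)) w s.
Definition f_span (w : M) : set M := lin_span (fun u => exists s, u = f_word w s).

Lemma wvec_f_word mu w s : is_wvec mu w -> is_wvec (mu - root_sum s) (f_word w s).
Proof.
move=> mw; elim: s => [|i s IH]; first by rewrite /root_sum big_nil subr0.
by rewrite /root_sum big_cons (addrC (al i)) opprD addrA; apply: wvec_f.
Qed.

Lemma f_span_sub w : is_subspace (f_span w). Proof. exact: span_subspace. Qed.

Lemma f_span_word w s : f_span w (f_word w s).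
Proof. by apply: span_gen; exists s. Qed.

Lemma f_span_f w i u : f_span w u -> f_span w (act (km_f g i) u).
Proof.
move: u; apply: span_least => [|_ [s ->]].
  exact: comp_preim_subspace (act_linr _) (f_span_sub w).
exact: (f_span_word w (i :: s)).
Qed.

(** A vector of the span is a sum of weight vectors for weights [mu - root_sum s]; if [nu] is none
    of these, [wvec_indep] makes the vector zero. *)
Lemma f_span_weight mu w nu u : is_wvec mu w -> f_span w u -> u != 0 ->
  is_wvec nu u -> exists s, nu = mu - root_sum s.
Proof.
move=> mw Su u0 nuu; apply/not_existsP => H; move/eqP: u0; apply.
suff [r Er Hr] : exists2 r : seq (weight X * M), u = \sum_(p <- r) p.2 &
    forall p, p \in r -> is_wvec p.1 p.2 /\ p.1 != nu.
  exact: (wvec_indep nuu Er Hr).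
elim: Su => [|c _ v [s ->] _ [r -> Hr]]; first by exists [::]; rewrite ?big_nil.
exists ((mu - root_sum s, c *: f_word w s) :: r); first by rewrite big_cons.
move=> p; rewrite inE => /orP [/eqP -> /=|/Hr //]; split.
  move=> x; rewrite (linZ (act_linr _)) (wvec_f_word s mw).
  by rewrite !scalerA mulrC.
by apply/eqP => /esym; apply: H.
Qed.

(** Moving [e_i] to the right through a word leaves only terms with a coroot, which acts on words by
    scalars. The elements of the algebra that preserve the span form a subalgebra, so the generators
    suffice. *)
Lemma f_span_submodule mu w : is_wvec mu w ->
  (forall i, act (km_e g i) w = 0) -> is_submodule (f_span w).
Proof.
move=> mw ew; split; first exact: f_span_sub.
have Ssub := f_span_sub w.
have Hh x u : f_span w u -> f_span w (act (km_h g x) u).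
  move: u; apply: span_least => [|_ [s ->]].
    exact: comp_preim_subspace (act_linr _) Ssub.
  rewrite (wvec_f_word s mw); apply: subspaceZ => //; exact: f_span_word.
have He i u : f_span w u -> f_span w (act (km_e g i) u).
  move: u; apply: span_least => [|_ [s ->]].
    exact: comp_preim_subspace (act_linr _) Ssub.
  elim: s => [|j s IH] /=; first by rewrite ew; case: Ssub.
  rewrite act_e_f; apply: subspaceD => //; first exact: f_span_f.
  case: eqP => _; last by case: Ssub.
  exact/Hh/f_span_word.
apply: (@km_generated _ _ _ g (fun x => forall v, f_span w v -> f_span w (act x v))).
- split; first split.
  + by move=> u _; rewrite (lin0 (act_linl u)); case: Ssub.
  + move=> c x y Sx Sy u Su; rewrite (act_linl u).
    by case: Ssub => _; apply; [apply: Sx | apply: Sy].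
  + move=> x y Sx Sy u Su; rewrite act_bracket.
    by apply: subspaceB => //; [apply/Sx/Sy | apply/Sy/Sx].
- by move=> x u; apply: Hh.
- by move=> x u; apply: He.
- by move=> x u; apply: f_span_f.
Qed.

(** Leibniz rule without binomial coefficients: f_i (x u) = x (f_i u) + [f_i, x] u lowers the
    exponent of [u] in one term and that of [x] in the other. *)
Lemma nil_act_f i (n K L : nat) x u : (K + L <= n)%N ->
  iter K (bracket (km_f g i)) x = 0 -> iter L (act (km_f g i)) u = 0 ->
  iter n (act (km_f g i)) (act x u) = 0.
Proof.
elim: n K L x u => [|n IH] [|K] [|L] x u //=.
- by move=> _ -> _; rewrite (lin0 (act_linl u)).
- by move=> _ -> _; rewrite (lin0 (act_linl u)) -iterS (lin0 (iter_lin _ (act_linr _))).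
- by move=> _ -> _; rewrite (lin0 (act_linl u)) -iterS (lin0 (iter_lin _ (act_linr _))).
- by move=> _ _ ->; rewrite (lin0 (act_linr x)) -iterS (lin0 (iter_lin _ (act_linr _))).
move=> le Hx Hu; rewrite -iterS iterSr act_comm (linD (iter_lin _ (act_linr _))).
rewrite (IH K.+1 L) ?add0r //; last by rewrite -iterSr.
  by rewrite (IH K L.+1) // -?iterSr //; lia.
by lia.
Qed.

End Generic.

Lemma root_sumE s : root_sum s = \sum_i al i *+ count_mem i s.
Proof.
rewrite /root_sum; elim: s => [|j s IH].
  by rewrite big_nil big1 // => i _.
rewrite big_cons IH /= (bigD1 j) //= [in RHS](bigD1 j) //= eqxx add1n mulrS addrA.
by congr (_ + _); apply: eq_bigr => i ij; rewrite eq_sym (negPf ij).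
Qed.

Lemma roots_indep (c : I -> C) : \sum_i c i *: al i = 0 -> forall i, c i = 0.
Proof.
have fr := simple_root_free X; move/freeP: fr => fr H i.
apply: (fr c); rewrite -[RHS]H; apply: eq_bigr => j _.
by rewrite nth_mktuple.
Qed.

Lemma roots_indepz (c : I -> int) : \sum_i al i *~ c i = 0 -> forall i, c i = 0.
Proof.
move=> H i; apply/eqP; rewrite -(@intr_eq0 C).
rewrite (roots_indep (c := fun i => (c i)%:~R)) // -[RHS]H.
by apply: eq_bigr => j _; rewrite scaler_int.
Qed.

Lemma root_sum_eq0 s : root_sum s = 0 -> s = [::].
Proof.
rewrite root_sumE => H; have {}H i : (count_mem i s)%:Z = 0.
  by apply: (roots_indepz (c := fun i => (count_mem i s)%:Z)).
by case: s H => [//|j s] /(_ j) /=; rewrite eqxx.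
Qed.

Lemma root_sum_cat s1 s2 : root_sum (s1 ++ s2) = root_sum s1 + root_sum s2.
Proof. exact: big_cat. Qed.

Lemma adj_bracket (x y v : g) :
  bracket (bracket x y) v = bracket x (bracket y v) - bracket y (bracket x v).
Proof.
have skew (a b : g) : bracket a b = - bracket b a.
  apply/eqP; rewrite -addr_eq0; apply/eqP.
  have := bracketxx (a + b); rewrite (linD (bracket_linearr (a + b))).
  rewrite (linD (bracket_linearl a)) (linD (bracket_linearl b)) !bracketxx.
  by rewrite add0r addr0 addrC.
rewrite [LHS]skew; have := jacobi x y v; rewrite (skew v x) (linN (bracket_linearr y)).
by move/eqP; rewrite addr_eq0 => /eqP ->.
Qed.

Definition adjoint : lie_module g :=
  LieModule (@bracket_linearl _ g) (@bracket_linearr _ g) adj_bracket.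

(* The ideal generated by [th] has only nonzero weights, hence meets the Cartan
   subalgebra trivially. *)
Lemma adjoint_singular (th : g) s : s != [::] ->
  is_wvec (M := adjoint) (- root_sum s) th ->
  (forall i, bracket (km_e g i) th = 0) -> th = 0.
Proof.
move=> s0 wth eth; have [Ssub Sact] := f_span_submodule wth eth.
apply: (km_ideal (k := g) (I := f_span (M := adjoint) th)) => //; last first.
  exact: (f_span_word (M := adjoint) th [::]).
move=> x Sx; apply: (@km_h_inj _ _ _ g); rewrite (lin0 (@km_h_linear _ _ _ g)).
apply/eqP/negPn/negP => hx.
have w0 : is_wvec (M := adjoint) 0 (km_h g x).
  by move=> y; rewrite /= km_hh lfunE /= scale0r.
have [s' E] := f_span_weight wth Sx hx w0.
have : root_sum (s ++ s') = 0.
  by apply/eqP; rewrite root_sum_cat -oppr_eq0 opprD -E.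
move/root_sum_eq0; case: (s) s0 => //.
Qed.

End Module.

(** * Integrability of L(Lam) *)

Section HighestWeight.
Variables (C : numFieldType) (t : affine_type) (X : affine_datum C t) (g : kac_moody X).
Notation I := 'I_(rank t).+1.
Notation al := (simple_root X).
Notation hc := (simple_coroot X).
Notation A := (cartan_matrix t).
Hypothesis A_diag : forall i, A i i = 2.
Hypothesis A_off : forall i j, i != j -> A i j <= 0.
Hypothesis A_zero : forall i j, A i j = 0 -> A j i = 0.

Lemma coroot_he (M : lie_module g) i (v : M) :
  mod_act (km_h g (hc i)) (mod_act (km_e g i) v) =
  mod_act (km_e g i) (mod_act (km_h g (hc i)) v) + 2 *: mod_act (km_e g i) v.
Proof.
rewrite act_comm km_he pairing_entry A_diag; congr (_ + _).
by rewrite (linZ (act_linl v)).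
Qed.

Lemma coroot_hf (M : lie_module g) i (v : M) :
  mod_act (km_h g (hc i)) (mod_act (km_f g i) v) =
  mod_act (km_f g i) (mod_act (km_h g (hc i)) v) - 2 *: mod_act (km_f g i) v.
Proof.
rewrite act_comm km_hf pairing_entry A_diag; congr (_ + _).
by rewrite (linN (act_linl v)) (linZ (act_linl v)).
Qed.

Lemma act_ef (M : lie_module g) i (v : M) :
  mod_act (km_e g i) (mod_act (km_f g i) v) =
  mod_act (km_f g i) (mod_act (km_e g i) v) + mod_act (km_h g (hc i)) v.
Proof. by rewrite act_e_f eqxx. Qed.

(** With n = -a_ij, the vector (ad f_i)^(n+1) f_j of the adjoint module is singular. For e_i this is
    the sl_2 formula at the end of a string of top weight n; the other e_k commute with f_i, which
    leaves only e_j to consider. *)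
Lemma serre i j : exists K, iter K (bracket (km_f g i)) (km_f g j) = 0.
Proof.
have [->|ij] := eqVneq i j; first by exists 1%N; rewrite /= bracketxx.
have Aij := A_off ij.
pose n := `|A i j|%N; have nE : A i j = - n%:Z by rewrite /n; lia.
exists n.+1.
pose M := adjoint g.
have wfj : is_wvec (M := M) (- al j) (km_f g j).
  by move=> x /=; rewrite km_hf !lfunE /= scaleNr.
have efj k : bracket (km_e g k) (km_f g j) = if k == j then km_h g (hc k) else 0.
  exact: km_ef.
have hfj : bracket (km_h g (hc i)) (km_f g j) = n%:R *: km_f g j.
  by rewrite km_hf pairing_entry nE intrN scaleNr opprK.
apply: (adjoint_singular (s := j :: nseq n.+1 i)) => // [|k].
  rewrite /root_sum big_cons big_nseq opprD iter_addr_0.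
  exact: (wvec_f_iter (M := M) i n.+1 wfj).
have [->|ki] := eqVneq k i.
  have := sl2_raise (act_linr (M := M) (km_f g i)) (act_ef (M := M) i)
    (coroot_hf (M := M) i) n _ hfj.
  rewrite subrr mulr0 scale0r; apply.
  by rewrite /= efj (negPf ij).
have comm u : bracket (km_e g k) (bracket (km_f g i) u) =
    bracket (km_f g i) (bracket (km_e g k) u).
  by have := act_e_f (M := M) k i u; rewrite /= (negPf ki) addr0.
have it q u : bracket (km_e g k) (iter q (bracket (km_f g i)) u) =
    iter q (bracket (km_f g i)) (bracket (km_e g k) u).
  by elim: q => //= q IH; rewrite comm IH.
rewrite it efj; have [->|_] := eqVneq k j; last first.
  exact: (lin0 (iter_lin _ (act_linr (M := M) (km_f g i)))).
have fh : bracket (km_f g i) (km_h g (hc j)) = (A j i)%:~R *: km_f g i.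
  have := bracketxx (km_f g i + km_h g (hc j)).
  rewrite (linD (bracket_linearr _)) !(linD (bracket_linearl _)) !bracketxx add0r addr0.
  by rewrite km_hf pairing_entry addrC => /eqP; rewrite subr_eq0 => /eqP.
(* One bracket with f_i turns h_j into a_ji f_i, and a second one kills it. When [n] is 0 there is
   no second bracket, but then a_ij = 0 forces a_ji = 0. *)
rewrite iterSr fh; case: n nE it hfj => [|n] nE _ _.
  rewrite /=; have -> : A j i = 0 by apply: A_zero; rewrite nE.
  exact: scale0r.
rewrite iterSr (linZ (bracket_linearr _)) bracketxx scaler0.
exact: (lin0 (iter_lin _ (act_linr (M := M) (km_f g i)))).
Qed.

Variables (V : lie_module g) (Lam : weight X).
Hypothesis Lam_dom : dominant_integral Lam.
Hypothesis V_irr : is_irr_highest_weight V Lam.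
Local Notation act := (@mod_act C g V).

Lemma hw_span : exists v : V, [/\ v != 0, is_wvec Lam v,
  forall i, act (km_e g i) v = 0 & forall u, f_span v u].
Proof.
have [[_ irr] [v [[v0 wv] ev]]] := V_irr; exists v; split=> //.
case: (irr _ (f_span_submodule wv ev)) => // H.
by have := H v (f_span_word v [::]) => /eqP; rewrite (negPf v0).
Qed.

Lemma weights_below mu : weights V mu -> exists s, mu = Lam - root_sum X s.
Proof.
have [v [v0 wv ev Sv]] := hw_span => -[u [u0 wu]].
exact: (f_span_weight wv (Sv u) u0 wu).
Qed.

Lemma weights_top : weights V Lam.
Proof. by have [v [v0 wv _ _]] := hw_span; exists v. Qed.

(** A nonzero singular vector generates the irreducible module, so the highest weight would lie
    below the weight of that vector, which is strictly below the highest weight. *)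
Lemma singular_zero (w : V) s : s != [::] -> is_wvec (Lam - root_sum X s) w ->
  (forall i, act (km_e g i) w = 0) -> w = 0.
Proof.
move=> s0 ww ew; have [v [v0 wv ev Sv]] := hw_span.
have [[_ irr] _] := V_irr.
case: (irr _ (f_span_submodule ww ew)) => [H|H].
  exact: (H w (f_span_word w [::])).
have [s' E] := f_span_weight ww (H v) v0 wv.
have : root_sum X (s ++ s') = 0.
  rewrite root_sum_cat; apply/eqP; rewrite -oppr_eq0 opprD.
  by rewrite -(inj_eq (addrI Lam)) addr0 addrA -E.
by move/root_sum_eq0; case: (s) s0.
Qed.

Lemma nil_subspace (f : V -> V) : linear f ->
  is_subspace (fun u => exists N, iter N f u = 0).
Proof.
move=> fl; split; first by exists 0%N.
move=> c u w [N HN] [N' HN']; exists (N + N')%N.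
rewrite (iter_lin _ fl) addnC iterD HN (lin0 (iter_lin _ fl)) scaler0 add0r.
by rewrite addnC iterD HN' (lin0 (iter_lin _ fl)).
Qed.

(** On a word of length n, n+1 applications of e_i would lead to a weight outside Lam - Q_+, the
    coefficient of alpha_i having the wrong sign. *)
Lemma e_nil i u : exists N, iter N (act (km_e g i)) u = 0.
Proof.
have [v [v0 wv ev Sv]] := hw_span.
move: u (Sv u); apply: span_least; first exact/nil_subspace/act_linr.
move=> _ [s ->]; exists (size s).+1; apply/eqP/negPn/negP => n0.
have [s' E] : exists s', Lam - root_sum X s + al i *+ (size s).+1 = Lam - root_sum X s'.
  apply: weights_below; exists (iter (size s).+1 (act (km_e g i)) (f_word v s)).
  by split=> //; apply: wvec_e_iter; apply: wvec_f_word.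
have : root_sum X (s' ++ nseq (size s).+1 i) = root_sum X s.
  rewrite root_sum_cat {2}/root_sum big_nseq iter_addr_0.
  move: E; rewrite -addrA => /addrI E.
  by apply/eqP; rewrite -subr_eq0 -addrA [_ *+ _ - _]addrC E subrr.
rewrite !root_sumE => /eqP; rewrite -subr_eq0 -sumrB => /eqP H.
have := roots_indepz (X := X) (c := fun j =>
  (count_mem j (s' ++ nseq (size s).+1 i))%:Z - (count_mem j s)%:Z) _ i.
rewrite count_cat count_nseq /= eqxx mul1n => H'.
have {}H' : (count_mem i s' + (size s).+1)%:Z - (count_mem i s)%:Z = 0.
  by apply: H'; rewrite -[RHS]H; apply: eq_bigr => j _; rewrite mulrzBr.
move/eqP: H'; rewrite subr_eq0 eqz_nat => /eqP H'.
by have := count_size (pred1 i) s; rewrite -H' addnS ltnNge leq_addl.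
Qed.

(** If n is the label of Lam at i, f_i^(n+1) sends the highest weight vector to a singular vector,
    hence to zero. The Serre relations and the Leibniz rule carry nilpotency along words. *)
Lemma f_nil i u : exists N, iter N (act (km_f g i)) u = 0.
Proof.
have [v [v0 wv ev Sv]] := hw_span.
move: u (Sv u); apply: span_least; first exact/nil_subspace/act_linr.
move=> _ [s ->]; elim: s => [|j s [L HL]] /=; last first.
  have [K HK] := serre i j; exists (K + L)%N.
  exact: (nil_act_f (leqnn _) HK HL).
have [n Hn] := Lam_dom i; exists n.+1.
apply: (singular_zero (s := nseq n.+1 i)) => // [|k].
  by rewrite /root_sum big_nseq iter_addr_0; apply: wvec_f_iter.
have hv : act (km_h g (hc i)) v = n%:R *: v by rewrite wv Hn.
have [->|ki] := eqVneq k i.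
  have := sl2_raise (act_linr (km_f g i)) (act_ef (M := V) i)
    (coroot_hf (M := V) i) n (ev i) hv.
  by rewrite subrr mulr0 scale0r.
elim: n.+1 => [|m IH]; first exact: ev.
by rewrite iterS act_e_f IH (negPf ki) addr0 (lin0 (act_linr _)).
Qed.

Lemma weights_string mu i (m j : int) : weights V mu -> mu (hc i) = m%:~R ->
  (0 <= j <= m) || (m <= j <= 0) -> weights V (mu - al i *~ j).
Proof.
move=> [u [u0 wu]] Hm /orP [/andP [j0 jm]|/andP [mj j0]].
  have hu : act (km_h g (hc i)) u = m%:~R *: u by rewrite wu Hm.
  have [|p Hp] := sl2_string (act_linr (km_e g i)) (act_linr (km_f g i))
    (act_ef (M := V) i) (coroot_hf (M := V) i)
    (coroot_he (M := V) i) u0 hu (e_nil i) (f_nil i) (j := `|j|%N); first by lia.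
  exists (iter (p + `|j|) (act (km_f g i)) (iter p (act (km_e g i)) u)); split=> //.
  have := wvec_f_iter i (p + `|j|) (wvec_e_iter i p wu).
  rewrite mulrnDr opprD addrA addrK.
  by have -> : al i *~ j = al i *+ `|j| by rewrite -[in LHS](gez0_abs j0).
(* For negative [m] the roles of e_i and f_i are exchanged, with h_i replaced by its negative. *)
have hu : - act (km_h g (hc i)) u = (- m)%:~R *: u by rewrite wu Hm intrN scaleNr.
have Nlin : linear (fun u => - act (km_h g (hc i)) u).
  by move=> c x y; rewrite act_linr opprD scalerN.
have [||||p Hp] := sl2_string (act_linr (km_f g i)) (act_linr (km_e g i))
    (H := fun u => - act (km_h g (hc i)) u) _ _ _ u0 hu (f_nil i) (e_nil i) (j := `|j|%N).
- by move=> w; rewrite act_ef addrK.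
- by move=> w; rewrite coroot_he opprD (linN (act_linr _)).
- by move=> w; rewrite coroot_hf opprB (linN (act_linr _)) addrC.
- by lia.
exists (iter (p + `|j|) (act (km_e g i)) (iter p (act (km_f g i)) u)); split=> //.
have := wvec_e_iter i (p + `|j|) (wvec_f_iter i p wu).
rewrite mulrnDr addrA subrK.
have -> : al i *~ j = - (al i *+ `|j|).
  by have {1}-> : j = - `|j|%N%:Z by [lia]; rewrite mulrNz.
by rewrite opprK.
Qed.

End HighestWeight.

(** * The affine quadratic form *)

Section AffineForm.
Variables (n : nat) (A : 'M[int]_n.+1) (m c : 'I_n.+1 -> nat).
Notation I := 'I_n.+1.
Hypothesis A_diag : forall i, A i i = 2.
Hypothesis A_off : forall i j, i != j -> A i j <= 0.
Hypothesis m_gt0 : forall i, (0 < m i)%N.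
Hypothesis c_gt0 : forall i, (0 < c i)%N.
Hypothesis A_mark : forall i, \sum_j A i j * (m j)%:Z = 0.
Hypothesis A_comark : forall j, \sum_i (c i)%:Z * A i j = 0.
Hypothesis A_sym : forall i j,
  (c i)%:Z * (m j)%:Z * A i j = (c j)%:Z * (m i)%:Z * A j i.
Hypothesis A_conn : forall Q : I -> Prop, Q ord0 ->
  (forall i j, Q i -> A i j != 0 -> Q j) -> forall i, Q i.

(** The Gram matrix of the vectors m_i alpha_i. In these coordinates the null root is the constant
    vector, so the rows sum to zero and the form is the Laplacian of the weighted diagram. *)
Definition fcoef i j : rat := ((c i)%:Z * A i j * (m j)%:Z)%:~R.

Lemma fcoef_sym i j : fcoef i j = fcoef j i.
Proof. by congr _%:~R; rewrite mulrAC A_sym mulrAC. Qed.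

Lemma fcoef_sum i : \sum_j fcoef i j = 0.
Proof.
rewrite -(rmorph_sum (intmul (1 : rat))) /=.
by under eq_bigr do rewrite -mulrA; rewrite -mulr_sumr A_mark mulr0.
Qed.

Lemma fcoef_le0 i j : i != j -> fcoef i j <= 0.
Proof.
move=> ij; rewrite lerz0 -mulrA mulr_ge0_le0 //.
by rewrite mulr_le0_ge0 // A_off.
Qed.

Lemma fcoef_edge i j : i != j -> A i j != 0 -> fcoef i j <= - 1.
Proof.
move=> ij Aij; rewrite -[-1]/((-1)%:~R : rat) ler_int.
have := A_off ij; have := m_gt0 j; have := c_gt0 i.
by move: (m j) (c i) (A i j) Aij => x y z; nia.
Qed.

Definition qform (z : I -> rat) : rat := \sum_i \sum_j fcoef i j * (z i * z j).

(* The row sums of [fcoef] vanish, so its form is a weighted sum of squares of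
   differences over the edges of the diagram. *)
Lemma qform_sq z :
  2 * qform z = \sum_i \sum_j - fcoef i j * (z i - z j) ^+ 2.
Proof.
have E1 : \sum_i \sum_j fcoef i j * z i ^+ 2 = 0.
  by rewrite big1 // => i _; rewrite -mulr_suml fcoef_sum mul0r.
have E2 : \sum_i \sum_j fcoef i j * z j ^+ 2 = 0.
  rewrite exchange_big big1 // => j _; rewrite -mulr_suml.
  by under eq_bigr do rewrite fcoef_sym; rewrite fcoef_sum mul0r.
transitivity (2 * qform z - \sum_i \sum_j fcoef i j * z i ^+ 2
  - \sum_i \sum_j fcoef i j * z j ^+ 2); first by rewrite E1 E2 !subr0.
rewrite /qform mulr_sumr -!sumrB.
apply: eq_bigr => i _; rewrite mulr_sumr -!sumrB; apply: eq_bigr => j _; ring.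
Qed.

Lemma qterm_ge0 z i j : 0 <= - fcoef i j * (z i - z j) ^+ 2.
Proof.
have [->|ij] := eqVneq i j; first by rewrite subrr expr0n mulr0.
by rewrite mulr_ge0 ?sqr_ge0 // oppr_ge0 fcoef_le0.
Qed.

Lemma qform_ge0 z : 0 <= qform z.
Proof.
rewrite -(@pmulr_rge0 _ 2) // qform_sq.
by apply: sumr_ge0 => i _; apply: sumr_ge0 => j _; apply: qterm_ge0.
Qed.

(** An edge occurs twice in the symmetric double sum, each time with an integral weight of at least
    one. *)
Lemma qform_edge z i j : i != j -> A i j != 0 -> (z i - z j) ^+ 2 <= qform z.
Proof.
move=> ij Aij; have ji : j != i by rewrite eq_sym.
have term k (F : I -> rat) : (forall k', 0 <= F k') -> F k <= \sum_k' F k'.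
  by move=> F0; rewrite (bigD1 k) //= lerDl sumr_ge0.
rewrite -(@ler_pM2l _ 2) // qform_sq (bigD1 i) //=.
have r1 := term j _ (qterm_ge0 z i).
have r2 := term i _ (qterm_ge0 z j).
have r3 : \sum_k - fcoef j k * (z j - z k) ^+ 2 <=
    \sum_(k | k != i) \sum_k' - fcoef k k' * (z k - z k') ^+ 2.
  rewrite [leRHS](bigD1 j) //= lerDl sumr_ge0 // => k _.
  by apply: sumr_ge0 => k' _; apply: qterm_ge0.
have e := fcoef_edge ij Aij; have s := sqr_ge0 (z i - z j).
move: r2; rewrite -(fcoef_sym i j) -[z j - z i]opprB sqrrN => r2.
have : (z i - z j) ^+ 2 <= - fcoef i j * (z i - z j) ^+ 2.
  by rewrite ler_peMl // lerNr.
lra.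
Qed.

Lemma qform_le0 z : qform z <= 0 -> forall i, z i = z ord0.
Proof.
move=> q0; apply: A_conn => // i j zi Aij; rewrite -zi.
have [->//|ij] := eqVneq i j.
have := le_trans (qform_edge z ij Aij) q0.
by rewrite le_eqVlt ltNge sqr_ge0 orbF sqrf_eq0 subr_eq0 => /eqP.
Qed.

Definition ratio (b : I -> int) (i : I) : rat := (b i)%:~R / (m i)%:R.

Lemma ratioK b i : ratio b i * (m i)%:R = (b i)%:~R.
Proof. by rewrite /ratio mulfVK // pnatr_eq0 -lt0n. Qed.

Lemma qform_ratio b : qform (ratio b) =
  \sum_i (c i)%:R * ratio b i * (\sum_j A i j * b j)%:~R.
Proof.
apply: eq_bigr => i _; rewrite (rmorph_sum (intmul (1 : rat))) mulr_sumr.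
apply: eq_bigr => j _; rewrite /fcoef /= !intrM -(ratioK b j); ring.
Qed.

(** The matrix has corank one; this pins down the marks, of which it is only known that they are
    coprime positive elements of the kernel. *)
Lemma kernel_marks (x : I -> int) : (forall i, \sum_j A i j * x j = 0) ->
  forall i, ratio x i = ratio x ord0.
Proof.
move=> H; apply: qform_le0; rewrite qform_ratio big1 // => i _.
by rewrite H mulr0.
Qed.

Variable L : I -> int.
Hypothesis L_ge0 : forall i, 0 <= L i.
Hypothesis level_gt0 : 0 < \sum_i (c i)%:Z * L i.

Definition pairing (b : I -> int) (i : I) : int := L i - \sum_j A i j * b j.

Lemma pairing_level b : \sum_i (c i)%:Z * pairing b i = \sum_i (c i)%:Z * L i.
Proof.
rewrite /pairing; under eq_bigr do rewrite mulrBr; rewrite sumrB.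
rewrite [X in _ - X](_ : _ = 0) ?subr0 //.
under eq_bigr do rewrite mulr_sumr; rewrite exchange_big big1 // => j _ /=.
by under eq_bigr do rewrite mulrA; rewrite -mulr_suml A_comark mul0r.
Qed.

(* Kac, Proposition 11.2: below a dominant weight of positive level a maximal
   chain of weights cannot get stuck. *)
Lemma dominant_unstuck (b b' : I -> int) :
    (forall i, b' i <= b i) -> (forall i, 0 <= pairing b i) ->
    (forall i, b' i < b i -> pairing b' i <= 0) -> b' = b.
Proof.
move=> le dom stuck.
pose x i := b i - b' i.
have px i : pairing b' i = pairing b i + \sum_j A i j * x j.
  have -> : \sum_j A i j * x j = \sum_j A i j * b j - \sum_j A i j * b' j.
    by rewrite -sumrB; apply: eq_bigr => j _; rewrite mulrBr.
  by rewrite /pairing; ring.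
have x0 i : 0 <= x i by rewrite subr_ge0.
have rx i : 0 <= ratio x i by rewrite /ratio divr_ge0 ?ler0z.
(* The form at [x] is the sum of the terms c_i (x_i / m_i) (A x)_i. Where x_i > 0, being stuck below
   a dominant weight forces (A x)_i <= 0, so the form is nonpositive and [x] is proportional to the
   marks. *)
have const : forall i, ratio x i = ratio x ord0.
  apply: qform_le0; rewrite qform_ratio; apply: sumr_le0 => i _.
  have [lt|ge] := ltP (b' i) (b i).
    apply: mulr_ge0_le0; first by apply: mulr_ge0.
    rewrite lerz0.
    by have := stuck i lt; rewrite px; have := dom i; lia.
  have -> : ratio x i = 0.
    by rewrite /ratio /x (_ : b i = b' i) ?subrr ?mul0r //; apply/le_anti/andP.
  by rewrite mulr0 mul0r.
have [z0|nz] := eqVneq (ratio x ord0) 0.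
  apply/funext => i; apply/eqP; rewrite eq_sym -subr_eq0 -(@intr_eq0 rat).
  by rewrite -(ratioK x) const z0 mul0r.
(* With a positive factor of proportionality, A x = 0 and every node is stuck, so all pairings of
   [b] vanish, against the positive level. *)
exfalso.
have lt i : b' i < b i.
  rewrite -subr_gt0 -/(x i) -(@ltr0z rat) -ratioK const mulr_gt0 ?ltr0n //.
  by rewrite lt_def nz rx.
have Ax i : \sum_j A i j * x j = 0.
  apply/eqP; rewrite -(@intr_eq0 rat) (rmorph_sum (intmul (1 : rat))) /=.
  under eq_bigr => j _ do rewrite intrM -(ratioK x) const mulrCA.
  rewrite -mulr_sumr -[X in _ * X](_ : (\sum_j A i j * (m j)%:Z)%:~R = _).
    by rewrite A_mark mulr0.
  rewrite (rmorph_sum (intmul (1 : rat))) /=.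
  by apply: eq_bigr => j _; rewrite intrM.
have p0 i : pairing b i = 0.
  by apply/le_anti/andP; split=> //; have := stuck i (lt i); rewrite px Ax addr0.
move: level_gt0; rewrite -(pairing_level b) big1 ?ltxx // => i _.
by rewrite p0 mulr0.
Qed.

(** The difference |eta|^2 - |Lam|^2 for eta = Lam - sum_i b_i alpha_i, where Lam has the labels
    [L]; hence its invariance under reflections. *)
Definition potential (b : I -> int) : rat :=
  qform (ratio b) - 2 * \sum_i (c i)%:R * (L i)%:~R * ratio b i.

Definition reflect_coord (i : I) (b : I -> int) : I -> int :=
  fun j => b j + (if j == i then pairing b i else 0).

Lemma potential_reflect i b : potential (reflect_coord i b) = potential b.
Proof.
pose d : I -> rat := fun j => if j == i then (pairing b i)%:~R / (m i)%:R else 0.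
have mi : (m i)%:R != 0 :> rat by rewrite pnatr_eq0 -lt0n.
have rE j : ratio (reflect_coord i b) j = ratio b j + d j.
  rewrite /ratio /reflect_coord /d intrD mulrDl; congr (_ + _).
  by case: eqP => [->|]; rewrite ?mul0r.
have dsum (f : I -> rat) : \sum_j f j * d j = f i * d i.
  rewrite (bigD1 i) //= big1 ?addr0 // => j ji.
  by rewrite /d (negPf ji) mulr0.
have row : \sum_j fcoef i j * ratio b j =
    (c i)%:R * ((L i)%:~R - (pairing b i)%:~R).
  rewrite -intrB /pairing opprB addrC subrK (rmorph_sum (intmul (1 : rat))) /=.
  rewrite mulr_sumr; apply: eq_bigr => j _.
  rewrite /fcoef !intrM -(ratioK b j) /=; ring.
have q : qform (fun j => ratio b j + d j) = qform (ratio b)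
    + 2 * (\sum_j fcoef i j * ratio b j) * d i + fcoef i i * d i ^+ 2.
  rewrite /qform.
  have -> : \sum_i0 \sum_j fcoef i0 j * ((ratio b i0 + d i0) * (ratio b j + d j))
    = \sum_i0 ((\sum_j fcoef i0 j * (ratio b i0 * ratio b j))
        + (\sum_j fcoef i0 j * ratio b j) * d i0
        + ratio b i0 * (\sum_j fcoef i0 j * d j)
        + (\sum_j fcoef i0 j * d j) * d i0).
    apply: eq_bigr => k _; rewrite !mulr_suml mulr_sumr -!big_split /=.
    by apply: eq_bigr => j _; ring.
  rewrite !big_split /= dsum dsum dsum.
  under [X in _ + X + _]eq_bigr => k _ do rewrite dsum fcoef_sym mulrCA mulrA.
  rewrite -mulr_suml; ring.
rewrite /potential.
have -> : qform (ratio (reflect_coord i b)) = qform (fun j => ratio b j + d j).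
  by congr qform; apply/funext.
have -> : \sum_j (c j)%:R * (L j)%:~R * ratio (reflect_coord i b) j
    = (\sum_j (c j)%:R * (L j)%:~R * ratio b j) + (c i)%:R * (L i)%:~R * d i.
  rewrite -(dsum (fun j => (c j)%:R * (L j)%:~R)) -big_split.
  by apply: eq_bigr => j _; rewrite /= rE mulrDr.
rewrite q row /d eqxx /fcoef A_diag !intrM /=.
have -> : ((m i)%:Z)%:~R = (m i)%:R :> rat by [].
have -> : ((c i)%:Z)%:~R = (c i)%:R :> rat by [].
by field.
Qed.

(** The form stays bounded because b <= b0, so along edges, and by connectedness everywhere, the
    coordinates b_i / m_i stay close to each other. As the form is nonnegative and the level
    positive, constancy of the potential bounds their common size from below. *)
Lemma potential_bound b0 : exists B : int, forall b,
  (forall i, b i <= b0 i) -> potential b = potential b0 -> B <= \sum_i b i.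
Proof.
pose ok b := (forall i, b i <= b0 i) /\ potential b = potential b0.
pose D := potential b0 + 2 * \sum_i (c i)%:R * (L i)%:~R * ratio b0 i.
have qD b : ok b -> qform (ratio b) <= D.
  move=> [le E]; rewrite /D -E /potential -addrA lerDl addrC subr_ge0.
  rewrite ler_pM2l //; apply: ler_sum => i _.
  by rewrite ler_wpM2l ?mulr_ge0 ?ler0z // /ratio ler_wpM2r ?invr_ge0 // ler_int.
have close i : exists K : rat, forall b, ok b -> `|ratio b i - ratio b ord0| <= K.
  move: i; apply: A_conn; first by exists 0 => b _; rewrite subrr normr0.
  (* The crude bound D + 1 for |u|, given u^2 <= D, avoids square roots. *)
  move=> i j [K HK] Aij; exists (K + (D + 1)) => b okb.
  have := HK b okb; have [->|ij] := eqVneq j i.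
    have := qD b okb; have := qform_ge0 (ratio b); lra.
  have Aij' : i != j by rewrite eq_sym.
  have := le_trans (qform_edge (ratio b) Aij' Aij) (qD b okb).
  move: (ratio b i) (ratio b j) (ratio b ord0) => x y z xy xz.
  have yx : `|x - y| <= D + 1.
    move: (x - y) xy => u xy; have D0 := le_trans (sqr_ge0 u) xy.
    have := sqr_ge0 (u - 1); have := sqr_ge0 (u + 1); move: xy.
    by rewrite ler_norml !expr2 => *; apply/andP; split; lra.
  rewrite (_ : y - z = (x - z) - (x - y)); last by ring.
  by rewrite (le_trans (ler_normB _ _)) // lerD.
have [K HK] : exists K : rat, forall b i, ok b -> `|ratio b i - ratio b ord0| <= K.
  have [f Hf] := choice close.
  exists (\sum_i `|f i|) => b i okb; apply: le_trans (Hf i b okb) _.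
  rewrite (bigD1 i) //= (le_trans (ler_norm _)) // lerDl.
  by apply: sumr_ge0.
pose k : rat := \sum_i (c i)%:R * (L i)%:~R.
have k0 : 0 < k.
  have -> : k = (\sum_i (c i)%:Z * L i)%:~R.
    rewrite (rmorph_sum (intmul (1 : rat))) /=.
    by apply: eq_bigr => i _; rewrite intrM.
  by rewrite ltr0z.
(* The solution of 0 <= potential b0 + 2 k (z + K) for the coordinate z at node 0. *)
pose z0 := - potential b0 / (2 * k) - K.
have low b i : ok b -> z0 - K <= ratio b i.
  move=> okb; have := HK b i okb; rewrite ler_norml => /andP [H _].
  suff : z0 <= ratio b ord0 by lra.
  have := qform_ge0 (ratio b).
  have -> : qform (ratio b) = potential b0 + 2 * \sum_i (c i)%:R * (L i)%:~R * ratio b i.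
    by case: okb => _ <-; rewrite /potential subrK.
  have : \sum_i (c i)%:R * (L i)%:~R * ratio b i <= k * (ratio b ord0 + K).
    rewrite /k mulr_suml; apply: ler_sum => j _.
    rewrite ler_wpM2l ?mulr_ge0 ?ler0z //.
    by have := HK b j okb; rewrite ler_norml => /andP [_]; lra.
  rewrite /z0 lerBlDr ler_pdivrMr ?mulr_gt0 //.
  lra.
pose B := - `|\sum_i (m i)%:R * (z0 - K)| - 1.
exists (Num.floor B) => b le E.
rewrite -(@ler_int rat) (le_trans (floor_le _)) //.
apply: (@le_trans _ _ (\sum_i (m i)%:R * (z0 - K))).
  by rewrite /B lerBlDr ler_wpDr // lerNl -normrN ler_norm.
rewrite (rmorph_sum (intmul (1 : rat))) /=; apply: ler_sum => i _.
by rewrite -ratioK mulrC ler_wpM2r // low.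
Qed.

(** Reflecting at a node with negative pairing keeps the potential and lowers the sum of the
    coordinates, which [potential_bound] bounds from below; so the recursion is well founded. *)
Lemma dominant_ind (R : (I -> int) -> Prop) :
    (forall b, (forall i, 0 <= pairing b i) -> R b) ->
    (forall b i, pairing b i < 0 -> R (reflect_coord i b) -> R b) ->
  forall b, R b.
Proof.
move=> Rdom Rstep b0; have [B HB] := potential_bound b0.
suff H N b : (forall i, b i <= b0 i) -> potential b = potential b0 ->
    (`|(\sum_i b i - B)%R| < N)%N -> R b.
  exact: (H _ b0 _ erefl (ltnSn _)).
elim: N b => // N IH b le E lt.
have [dom|/existsP [i Hi]] := boolP [forall i, 0 <= pairing b i].
  by apply: Rdom => i; apply: (forallP dom).
rewrite -ltNge in Hi; apply: (Rstep _ _ Hi).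
have S : \sum_j reflect_coord i b j = \sum_j b j + pairing b i.
  rewrite big_split /=; congr (_ + _); rewrite -big_mkcond big_pred1_eq //.
have ler j : reflect_coord i b j <= b0 j.
  apply: le_trans (le j).
  by rewrite /reflect_coord gerDl; case: eqP => // _; apply: ltW.
have Er : potential (reflect_coord i b) = potential b0 by rewrite potential_reflect.
apply: (IH _ ler Er); have := HB _ ler Er; have := HB _ le E; move: lt; rewrite S; lia.
Qed.

End AffineForm.

(** * Combinatorics of the affine diagrams *)

(** Coordinates are functions on all of [nat], so that tables and recursive constructions need no
    ordinals; only the values up to the rank matter. *)
Definition rowsum (t : affine_type) (x : nat -> int) (i : nat) : int :=
  \sum_(j < (rank t).+1) cartan_entry t i j * x j.

Lemma rowsum_supp t x i (s : seq nat) : uniq s -> all (fun j => j <= rank t)%N s ->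
    (forall j, (j <= rank t)%N -> j \notin s -> cartan_entry t i j * x j = 0) ->
  rowsum t x i = \sum_(j <- s) cartan_entry t i j * x j.
Proof.
move=> us /allP ss H.
rewrite /rowsum -(big_mkord xpredT (fun j => cartan_entry t i j * x j)).
rewrite (bigID [in s]) /= [X in _ + X]big1_seq ?addr0; last first.
  by move=> j /andP [js]; rewrite mem_index_iota => /andP [_ jr]; apply: H.
rewrite -big_filter; apply: perm_big; apply: uniq_perm => //.
  by rewrite filter_uniq // iota_uniq.
move=> j; rewrite mem_filter mem_index_iota /=.
by have [/ss|] := boolP (j \in s); rewrite ?ltnS.
Qed.

Lemma mem_path_edges m n i j :
  ((i, j) \in path_edges m n) = [&& m <= i, i < n & j == i.+1]%N.
Proof.
apply/mapP/and3P => [[k]|[mi iN /eqP ->]].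
  by rewrite mem_iota => /andP [mk kn] [-> ->]; split=> //; lia.
by exists i => //; rewrite mem_iota; lia.
Qed.

(** Kac's labels as tables; [marks_unique] shows that the marks of every datum agree with them. *)
Definition mark0 (t : affine_type) (i : nat) : nat :=
  match t with
  | A1 _ | D2 _ => 1
  | B1 _ => if (i < 2)%N then 1 else 2
  | C1 l => if (i == 0%N) || (i == l) then 1 else 2
  | D1 l => if (i < 2)%N || (l.-1 <= i)%N then 1 else 2
  | A2odd l => if (i < 2)%N || (i == l) then 1 else 2
  | A2even l => if i == l then 1 else 2
  | E6_1 => nth 0 [:: 1; 1; 2; 3; 2; 1; 2] i
  | E7_1 => nth 0 [:: 1; 2; 3; 4; 3; 2; 1; 2] i
  | E8_1 => nth 0 [:: 1; 2; 3; 4; 5; 6; 4; 2; 3] i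
  | F4_1 => nth 0 [:: 1; 2; 3; 4; 2] i
  | E6_2 => nth 0 [:: 1; 2; 3; 2; 1] i
  | G2_1 => nth 0 [:: 1; 2; 3] i
  | D4_3 => nth 0 [:: 1; 2; 1] i
  end%N.

(* A type whose comarks are given by [mark0] of another type has the transpose
   of the matrix of that type. *)
Definition comark0 (t : affine_type) (i : nat) : nat :=
  match t with
  | C1 _ => 1
  | B1 l => mark0 (A2odd l) i
  | A2odd l => mark0 (B1 l) i
  | D2 l => mark0 (C1 l) i
  | A2even l => if i == 0%N then 1 else 2
  | F4_1 => mark0 E6_2 i
  | E6_2 => mark0 F4_1 i
  | G2_1 => mark0 D4_3 i
  | D4_3 => mark0 G2_1 i
  | _ => mark0 t i
  end%N.

Ltac simp_bool := rewrite ?eqxx ?(andbF, andbT, orbF, orbT) /=.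

(* Deciding the tests on node numbers one by one keeps the proof terms small. *)
Ltac decide_tests :=
  simp_bool;
  repeat (match goal with
  | |- context [@eq_op Datatypes_nat__canonical__eqtype_Equality ?x ?y] =>
      first [ rewrite (_ : (x == y) = false); [|by lia]
            | rewrite (_ : (x == y) = true); [|by lia] ]
  | |- context [leq ?x ?y] =>
      first [ rewrite (_ : leq x y = true); [|by lia]
            | rewrite (_ : leq x y = false); [|by lia] ]
  end; simp_bool).

Ltac entries :=
  rewrite ?big_cons ?big_nil /cartan_entry /=;
  try match goal with H : is_true (?l != 1%N) |- _ => rewrite ?(negPf H) /= end;
  rewrite ?(in_cons, mem_path_edges, xpair_eqE) /=;
  decide_tests; try lia; repeat (case: ifP => ? /=; try lia); try lia.

Lemma rowsum_eq t x i (s : seq nat) v : uniq s -> all (fun j => j <= rank t)%N s ->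
    (forall j, (j <= rank t)%N -> j \notin s -> cartan_entry t i j * x j = 0) ->
  \sum_(j <- s) cartan_entry t i j * x j = v -> rowsum t x i = v.
Proof. by move=> us al H <-; apply: rowsum_supp. Qed.

(** A fold over numerals can be evaluated by [vm_compute], which settles the exceptional types. *)
Lemma rowsum_foldr t x i : rowsum t x i =
  foldr (fun j s => cartan_entry t i j * x j + s) 0 (iota 0 (rank t).+1).
Proof.
rewrite /rowsum -(big_mkord xpredT (fun j => cartan_entry t i j * x j)).
rewrite /index_iota subn0.
by elim: (iota _ _) => [|j s IH]; rewrite ?big_nil // big_cons IH.
Qed.

(* [s] lists the columns in which row [i] can be nonzero. *)
Ltac row s :=
  apply: (rowsum_eq (s := s));
  [ rewrite /= ?inE; lia | rewrite /=; lia
  | let j := fresh "j" in let jl := fresh "jl" in let js := fresh "js" in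
    move=> j /= jl; rewrite ?inE => js; apply/eqP; rewrite mulf_eq0; apply/orP; left;
    apply/eqP; entries
  | entries ].

Lemma mark0_row_A1 l i : (0 < l)%N -> (i <= l)%N ->
  rowsum (A1 l) (fun j => (mark0 (A1 l) j)%:Z) i = 0.
Proof.
move=> lv il; rewrite /mark0.
have [l1|l2] := eqVneq l 1%N; first by subst l; row [:: 0; 1]%N.
have [i0|i0] := eqVneq i 0%N; first by row [:: 0; 1; l]%N.
have [il'|il'] := eqVneq i l; first by row [:: l; l.-1; 0]%N.
by row [:: i; i.-1; i.+1]%N.
Qed.

Lemma mark0_row_B1 l i : (2 < l)%N -> (i <= l)%N ->
  rowsum (B1 l) (fun j => (mark0 (B1 l) j)%:Z) i = 0.
Proof.
move=> lv il; rewrite /mark0.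
have [i0|i0] := eqVneq i 0%N; first by row [:: 0; 2]%N.
have [i1|i1] := eqVneq i 1%N; first by row [:: 1; 2]%N.
have [i2|i2] := eqVneq i 2%N; first by row [:: 0; 1; 2; 3]%N.
have [il'|il'] := eqVneq i l; first by row [:: l; l.-1]%N.
by row [:: i; i.-1; i.+1]%N.
Qed.

Lemma mark0_row_C1 l i : (1 < l)%N -> (i <= l)%N ->
  rowsum (C1 l) (fun j => (mark0 (C1 l) j)%:Z) i = 0.
Proof.
move=> lv il; rewrite /mark0.
have [i0|i0] := eqVneq i 0%N; first by row [:: 0; 1]%N.
have [il'|il'] := eqVneq i l; first by row [:: l; l.-1]%N.
by row [:: i; i.-1; i.+1]%N.
Qed.

Lemma mark0_row_D1 l i : (3 < l)%N -> (i <= l)%N ->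
  rowsum (D1 l) (fun j => (mark0 (D1 l) j)%:Z) i = 0.
Proof.
move=> lv il; rewrite /mark0.
have [i0|i0] := eqVneq i 0%N; first by row [:: 0; 2]%N.
have [i1|i1] := eqVneq i 1%N; first by row [:: 1; 2]%N.
have [il'|il'] := eqVneq i l; first by row [:: l; l.-2]%N.
have [il''|il''] := eqVneq i l.-1; first by row [:: l.-1; l.-2]%N.
have [i2|i2] := eqVneq i 2%N.
  have [l4|l4] := eqVneq l 4%N; first by row [:: 0; 1; 2; 3; 4]%N.
  by row [:: 0; 1; 2; 3]%N.
have [il2|il2] := eqVneq i l.-2; first by row [:: l; l.-1; l.-2; (l - 3)%N].
by row [:: i; i.-1; i.+1]%N.
Qed.

Lemma mark0_row_D2 l i : (1 < l)%N -> (i <= l)%N ->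
  rowsum (D2 l) (fun j => (mark0 (D2 l) j)%:Z) i = 0.
Proof.
move=> lv il; rewrite /mark0.
have [i0|i0] := eqVneq i 0%N; first by row [:: 0; 1]%N.
have [il'|il'] := eqVneq i l; first by row [:: l; l.-1]%N.
by row [:: i; i.-1; i.+1]%N.
Qed.

Lemma mark0_row_A2odd l i : (2 < l)%N -> (i <= l)%N ->
  rowsum (A2odd l) (fun j => (mark0 (A2odd l) j)%:Z) i = 0.
Proof.
move=> lv il; rewrite /mark0.
have [i0|i0] := eqVneq i 0%N; first by row [:: 0; 2]%N.
have [i1|i1] := eqVneq i 1%N; first by row [:: 1; 2]%N.
have [i2|i2] := eqVneq i 2%N; first by row [:: 0; 1; 2; 3]%N.
have [il'|il'] := eqVneq i l; first by row [:: l; l.-1]%N.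
by row [:: i; i.-1; i.+1]%N.
Qed.

Lemma mark0_row_A2even l i : (0 < l)%N -> (i <= l)%N ->
  rowsum (A2even l) (fun j => (mark0 (A2even l) j)%:Z) i = 0.
Proof.
move=> lv il; rewrite /mark0.
have [l1|l2] := eqVneq l 1%N; first by subst l; row [:: 0; 1]%N.
have [i0|i0] := eqVneq i 0%N; first by row [:: 0; 1]%N.
have [il'|il'] := eqVneq i l; first by row [:: l; l.-1]%N.
by row [:: i; i.-1; i.+1]%N.
Qed.

Lemma mark0_row t i : valid_type t -> (i <= rank t)%N ->
  rowsum t (fun j => (mark0 t j)%:Z) i = 0.
Proof.
case: t => [l|l|l|l|l|l|l|||||||] lv il.
- exact: mark0_row_A1.
- exact: mark0_row_B1.
- exact: mark0_row_C1.
- exact: mark0_row_D1.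
- exact: mark0_row_D2.
- exact: mark0_row_A2odd.
- exact: mark0_row_A2even.
all: apply/eqP; rewrite rowsum_foldr; move: i il.
all: match goal with |- forall i, is_true (leq i ?n) -> is_true (@?P i) =>
  suff H : all P (iota 0 n.+1) by
    move=> i il; apply: (allP H); rewrite mem_iota end.
all: by vm_compute.
Qed.

Ltac concrete :=
  match goal with |- forall i, is_true (leq i ?n) -> is_true (@?P i) =>
    let H := fresh "H" in
    suff H : all P (iota 0 n.+1) by
      let i := fresh "i" in let il := fresh "il" in
      move=> i il; apply: (allP H); rewrite mem_iota end; by vm_compute.

Lemma cartan_entry_diag t i : cartan_entry t i i = 2.
Proof. by rewrite /cartan_entry eqxx. Qed.

Lemma cartan_entry_off t i j : i != j -> cartan_entry t i j <= 0.
Proof.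
move=> /negPf ij; rewrite /cartan_entry ij.
have : all (fun x => x.2 <= 0) (exceptions t).
  by case: t => //= l; case: (l == 1%N).
elim: (exceptions t) => [|x s IH] /=; first by case: ifP.
by case: (x.1 == (i, j)) => /= /andP [x0 /IH].
Qed.

Lemma mark0_gt0 t i : (i <= rank t)%N -> (0 < mark0 t i)%N.
Proof.
case: t => [l|l|l|l|l|l|l|||||||] /=; rewrite /mark0 //; try by case: ifP.
all: by move: i; concrete.
Qed.

Lemma comark0_gt0 t i : (i <= rank t)%N -> (0 < comark0 t i)%N.
Proof.
case: t => [l|l|l|l|l|l|l|||||||] /=; rewrite /comark0 /mark0 //; try by case: ifP.
all: by move: i; concrete.
Qed.

Lemma comark0_0 t : valid_type t -> comark0 t 0 = 1%N.
Proof. by case: t => // l; rewrite /comark0 /mark0 /=; case: ifP => //; lia. Qed.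

(** A node of mark one normalizes kernel vectors of the matrix and shows that a multiple of delta in
    Q is an integral one. In type [A2even] node 0 has mark 2 and the other end serves. *)
Lemma mark0_unit t : valid_type t -> exists2 p, (p <= rank t)%N & mark0 t p = 1%N.
Proof.
case: t => [l|l|l|l|l|l|l|||||||] lt; try by exists 0%N.
by exists l; rewrite //= eqxx.
Qed.

Lemma cartan_entry_simply_laced t i j : exceptions t = [::] ->
  cartan_entry t i j = cartan_entry t j i.
Proof. by move=> E; rewrite /cartan_entry E /= eq_sym orbC. Qed.

Definition label_sym (t : affine_type) (i j : nat) : Prop :=
  (comark0 t i)%:Z * (mark0 t j)%:Z * cartan_entry t i j =
  (comark0 t j)%:Z * (mark0 t i)%:Z * cartan_entry t j i.

Lemma label_sym_B1 l i j : (2 < l)%N -> (i < j)%N -> (j <= l)%N -> label_sym (B1 l) i j.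
Proof. by move=> lv ij jl; rewrite /label_sym /comark0 /mark0; entries. Qed.

Lemma label_sym_C1 l i j : (1 < l)%N -> (i < j)%N -> (j <= l)%N -> label_sym (C1 l) i j.
Proof. by move=> lv ij jl; rewrite /label_sym /comark0 /mark0; entries. Qed.

Lemma label_sym_D2 l i j : (1 < l)%N -> (i < j)%N -> (j <= l)%N -> label_sym (D2 l) i j.
Proof. by move=> lv ij jl; rewrite /label_sym /comark0 /mark0; entries. Qed.

Lemma label_sym_A2odd l i j : (2 < l)%N -> (i < j)%N -> (j <= l)%N -> label_sym (A2odd l) i j.
Proof. by move=> lv ij jl; rewrite /label_sym /comark0 /mark0; entries. Qed.

Lemma label_sym_A2even l i j : (0 < l)%N -> (i < j)%N -> (j <= l)%N ->
  label_sym (A2even l) i j.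
Proof.
move=> lv ij jl; rewrite /label_sym /comark0 /mark0.
have [l1|l2] := eqVneq l 1%N; last by entries.
by subst l; have -> : i = 0%N by [lia]; have -> : j = 1%N by lia.
Qed.

Lemma mark0_sym t i j : valid_type t -> (i <= rank t)%N -> (j <= rank t)%N ->
  label_sym t i j.
Proof.
have [->//|ij] := eqVneq i j.
wlog lt : i j ij / (i < j)%N.
  move=> W tv ir jr; have [l|l|E] := ltngtP i j; first exact: W.
    by apply/esym/(W j i); rewrite // eq_sym.
  by rewrite E eqxx in ij.
have sl : mark0 t =1 comark0 t -> exceptions t = [::] -> label_sym t i j.
  move=> E ex; rewrite /label_sym -!E cartan_entry_simply_laced //.
  by rewrite [(mark0 t i)%:Z * _]mulrC.
case: t sl => [l|l|l|l|l|l|l|||||||] sl /= lv il jl; try exact: sl.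
- have [l1|l2] := eqVneq l 1%N; last by apply: sl => //; rewrite /= (negPf l2).
  by subst l; clear sl; have -> : i = 0%N by [lia]; have -> : j = 1%N by lia.
- exact: label_sym_B1.
- exact: label_sym_C1.
- exact: label_sym_D2.
- exact: label_sym_A2odd.
- exact: label_sym_A2even.
all: rewrite /label_sym; apply/eqP; move: i il j jl {ij lt sl}.
all: match goal with |- forall i, is_true (leq i ?n) -> forall j, _ -> is_true (@?P i j) =>
  suff H : all (fun i => all (P i) (iota 0 n.+1)) (iota 0 n.+1) by
    move=> i il j jl; apply: (allP (allP H i _)); rewrite mem_iota end.
all: by vm_compute.
Qed.

(* [parent] describes a spanning tree of the diagram with root 0, along which
   [depth] increases. *)
Definition depth (t : affine_type) (i : nat) : nat :=
  match t with
  | B1 _ | D1 _ | A2odd _ => if i == 1%N then 2 else if i == 2%N then 1 else i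
  | E6_1 => nth 0%N [:: 0; 5; 4; 3; 4; 5; 1] i
  | _ => i
  end%N.

Definition parent (t : affine_type) (i : nat) : nat :=
  match t with
  | B1 _ | A2odd _ => if i == 1%N then 2 else if i == 2%N then 0 else i.-1
  | D1 l => if i == l then l.-2 else
            if i == 1%N then 2 else if i == 2%N then 0 else i.-1
  | E6_1 => nth 0%N [:: 0; 2; 3; 6; 3; 4; 0] i
  | E7_1 => if i == 7%N then 3 else i.-1
  | E8_1 => if i == 8%N then 5 else i.-1
  | _ => i.-1
  end%N.

Lemma parent_edge t i : valid_type t -> (0 < i)%N -> (i <= rank t)%N ->
  [&& (parent t i <= rank t)%N, (depth t (parent t i) < depth t i)%N
    & cartan_entry t (parent t i) i != 0].
Proof.
case: t => [l|l|l|l|l|l|l|||||||] /= lv i0 il; rewrite /parent /depth.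
- have [l1|l2] := eqVneq l 1%N; first by subst l; have -> : i = 1%N by lia.
  by apply/and3P; split; entries.
- have [->|i1] := eqVneq i 1%N; first by apply/and3P; split; entries.
  have [->|i2] := eqVneq i 2%N; first by apply/and3P; split; entries.
  have -> : (i.-1 == 1%N) = false by lia.
  by apply/and3P; split; entries.
- by apply/and3P; split; entries.
- have [->|i3] := eqVneq i l.
    have -> : (l.-2 == 1%N) = false by lia.
    by apply/and3P; split; entries.
  have [->|i1] := eqVneq i 1%N; first by apply/and3P; split; entries.
  have [->|i2] := eqVneq i 2%N; first by apply/and3P; split; entries.
  have -> : (i.-1 == 1%N) = false by lia.
  by apply/and3P; split; entries.
- by apply/and3P; split; entries.
- have [->|i1] := eqVneq i 1%N; first by apply/and3P; split; entries.
  have [->|i2] := eqVneq i 2%N; first by apply/and3P; split; entries.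
  have -> : (i.-1 == 1%N) = false by lia.
  by apply/and3P; split; entries.
- have [l1|l2] := eqVneq l 1%N; first by subst l; have -> : i = 1%N by lia.
  by apply/and3P; split; entries.
all: by move: i0; apply/implyP; move: i il; concrete.
Qed.

Lemma diagram_connected t (Q : nat -> Prop) : valid_type t -> Q 0%N ->
    (forall i j, (i <= rank t)%N -> (j <= rank t)%N -> Q i ->
       cartan_entry t i j != 0 -> Q j) ->
  forall i, (i <= rank t)%N -> Q i.
Proof.
move=> tv Q0 QS i; have [n] := ubnP (depth t i); elim: n i => // n IH i lt ir.
have [->//|] := posnP i => i0.
have /and3P [pr pd pe] := parent_edge tv i0 ir.
by apply: (QS (parent t i)) => //; apply: IH => //; lia.
Qed.

(** * Conjugacy of theta to a simple root *)

Definition unit_coord (i : nat) : nat -> int := fun j => (j == i)%:Z.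

(** Coordinates of theta = delta - a_0 alpha_0. In the twisted types other than [A2even] it is the
    highest short root of the finite root system. *)
Definition highest (t : affine_type) : nat -> int :=
  fun j => if j == 0%N then 0 else (mark0 t j)%:Z.

(* Coordinates of the images of the simple roots 1, ..., l under the finite
   Weyl group. *)
Inductive reach (t : affine_type) : (nat -> int) -> Prop :=
  | reach_simple i : (0 < i)%N -> (i <= rank t)%N -> reach t (unit_coord i)
  | reach_step i x : (0 < i)%N -> (i <= rank t)%N -> reach t x ->
      reach t (fun j => x j - (if j == i then rowsum t x i else 0))
  | reach_ext x y : reach t x -> (forall j, (j <= rank t)%N -> y j = x j) ->
      reach t y.

(* Coordinates of the lattice generated by the orbit of the highest root. *)
Inductive orbit_lattice (t : affine_type) : (nat -> int) -> Prop :=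
  | lattice_highest : orbit_lattice t (highest t)
  | lattice_sub x y : orbit_lattice t x -> orbit_lattice t y ->
      orbit_lattice t (fun j => x j - y j)
  | lattice_reflect i x : (0 < i)%N -> (i <= rank t)%N -> orbit_lattice t x ->
      orbit_lattice t (fun j => x j - (if j == i then rowsum t x i else 0))
  | lattice_ext x y : orbit_lattice t x ->
      (forall j, (j <= rank t)%N -> y j = x j) -> orbit_lattice t y.

Lemma reach_move t x y i (r : int) : reach t x -> (0 < i)%N -> (i <= rank t)%N ->
    rowsum t x i = - r ->
    (forall j, (j <= rank t)%N -> y j = if j == i then x j + r else x j) ->
  reach t y.
Proof.
move=> xr i0 il E H; apply: reach_ext (reach_step i0 il xr) _ => j jl.
by rewrite H // E; case: ifP; rewrite ?opprK ?subr0.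
Qed.

(* When nodes 1, ..., l form a path, the highest root is built from alpha_l by
   adding one node after the other, downwards. *)
Definition upper_part (t : affine_type) (m : nat) : nat -> int :=
  fun j => if (0 < j)%N && (m <= j)%N then (mark0 t j)%:Z else 0.

Lemma reach_highest_path t : valid_type t ->
  match t with A1 _ | C1 _ | D2 _ | A2even _ => true | _ => false end ->
  reach t (highest t).
Proof.
move=> tv tp.
have l0 : (0 < rank t)%N by case: t tv tp => //= l; lia.
have step m : (0 < m)%N -> (m < rank t)%N ->
    rowsum t (upper_part t m.+1) m = - (mark0 t m)%:Z.
  move=> m0 ml; case: t tv tp ml {l0} => [l|l|l|l|l|l|l|||||||] //= tv _ ml;
    rewrite /upper_part /mark0.
  - have l1 : l != 1%N by lia.
    by row [:: m; m.-1; m.+1]%N.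
  - by row [:: m; m.-1; m.+1]%N.
  - by row [:: m; m.-1; m.+1]%N.
  - have l1 : l != 1%N by lia.
    by row [:: m; m.-1; m.+1]%N.
have H k : (k < rank t)%N -> reach t (upper_part t (rank t - k)).
  elim: k => [|k IH] kl.
    apply: reach_ext (reach_simple l0 (leqnn _)) _ => j jl; rewrite subn0 /upper_part /unit_coord.
    have [->|jn] := eqVneq j (rank t).
      rewrite l0 leqnn /=; case: t tv tp {l0 step kl jl} => //= l; rewrite /mark0 ?eqxx ?orbT //.
    by case: ifP => // ; lia.
  have m0 : (0 < rank t - k.+1)%N by lia.
  have ml : (rank t - k.+1 < rank t)%N by lia.
  have E : (rank t - k = (rank t - k.+1).+1)%N by lia.
  apply: (reach_move (IH _) m0 _ _ (r := (mark0 t (rank t - k.+1))%:Z)); try lia.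
    by rewrite E step.
  move=> j jl; rewrite /upper_part; case: eqP => [->|]; last by repeat case: ifP; lia.
  by rewrite ifT ?ifF ?add0r //; lia.
apply: reach_ext (H (rank t).-1 _) _; first by lia.
by move=> j jl; rewrite /highest /upper_part; case: j jl => //= j jl; rewrite ifT //; lia.
Qed.

(* For the forked diagrams one goes from alpha_1 up to the other end, and then
   down again to node 2, raising the coefficients from 1 to 2. *)
Definition ones (m : nat) : nat -> int := fun j => (0 < j <= m)%N%:Z.

Definition ones_upper (t : affine_type) (m : nat) : nat -> int :=
  fun j => if j == 0%N then 0 else if (j < m)%N then 1 else (mark0 t j)%:Z.

Lemma reach_ones t m : valid_type t ->
  match t with B1 l | A2odd l => m < l | D1 l => m <= l.-1 | _ => false end%N ->
  (0 < m)%N -> reach t (ones m).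
Proof.
move=> tv; elim: m => // m IH tm _.
have ml : (m < rank t)%N by case: t tv tm {IH} => //= l; lia.
have [m0|m0] := posnP m.
  apply: (reach_ext (reach_simple (i := m.+1) _ _)) => // j jl.
  by rewrite /ones /unit_coord m0; case: j {jl} => [|[|j]].
apply: (reach_move (x := ones m) (i := m.+1) (r := 1)) => //; last 2 first.
- case: t tv tm {IH ml} => [l|l|l|l|l|l|l|||||||] //= lv tm; rewrite /ones.
  + have [m1|m1] := eqVneq m 1%N; first by subst m; row [:: 0; 1; 2; 3]%N.
    by row [:: m.+1; m; m.+2]%N.
  + have [ml|ml] := eqVneq m (l - 2)%N; first by row [:: m.+1; m]%N.
    have [ml'|ml'] := eqVneq m (l - 3)%N.
      have [m1|m1] := eqVneq m 1%N.
        by subst m; row [:: 0; 1; 2; 3; 4]%N.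
      by row [:: m.+1; m; m.+2; l]%N.
    have [m1|m1] := eqVneq m 1%N; first by subst m; row [:: 0; 1; 2; 3]%N.
    by row [:: m.+1; m; m.+2]%N.
  + have [m1|m1] := eqVneq m 1%N; first by subst m; row [:: 0; 1; 2; 3]%N.
    by row [:: m.+1; m; m.+2]%N.
- by move=> j jl; rewrite /ones; case: eqP => [->|] *; lia.
apply: IH => //; case: t tv tm {ml} => //= l; lia.
Qed.

Lemma reach_highest_fork t : valid_type t ->
  match t with B1 _ | A2odd _ | D1 _ => true | _ => false end ->
  reach t (highest t).
Proof.
move=> tv tp.
(* The turning point of the path. In type B the reflection at the short end raises the coefficient
   from 0 to 2 at once; in type D both end nodes l-1 and l have mark one. *)
have start : reach t (ones_upper t (if t is D1 l then l.-1 else rank t)).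
  case: t tv tp => [l|l|l|l|l|l|l|||||||] //= lv _.
  - apply: (reach_move (x := ones l.-1) (i := l) (r := 2)) => //=; try lia.
    + by apply: reach_ones => //=; lia.
    + by rewrite /ones; row [:: l; l.-1]%N.
    + by move=> j jl; rewrite /ones_upper /ones /mark0; repeat (case: ifP => ?); lia.
  - apply: (reach_move (x := ones l.-1) (i := l) (r := 1)) => //=; try lia.
    + by apply: reach_ones => //=; lia.
    + by rewrite /ones; row [:: l; l.-2]%N.
    + by move=> j jl; rewrite /ones_upper /ones /mark0; repeat (case: ifP => ?); lia.
  - apply: (reach_move (x := ones l.-1) (i := l) (r := 1)) => //=; try lia.
    + by apply: reach_ones => //=; lia.
    + by rewrite /ones; row [:: l; l.-1]%N.
    + by move=> j jl; rewrite /ones_upper /ones /mark0; repeat (case: ifP => ?); lia.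
set top := (if t is D1 l then _ else _) in start.
have t2 : (2 < top)%N by rewrite /top; case: (t) tv tp => //= l; lia.
have tr : (top <= rank t)%N by rewrite /top; case: (t) tv tp => //= l; lia.
have step m : (1 < m)%N -> (m < top)%N -> rowsum t (ones_upper t m.+1) m = - 1.
  rewrite /top /ones_upper /mark0; case: (t) tv tp => [l|l|l|l|l|l|l|||||||] //= lv _ m1 ml.
  - have [->|m2] := eqVneq m 2%N; first by row [:: 0; 1; 2; 3]%N.
    by row [:: m; m.-1; m.+1]%N.
  - have [->|m2] := eqVneq m 2%N.
      have [l4|l4] := eqVneq l 4%N; first by row [:: 0; 1; 2; 3; 4]%N.
      by row [:: 0; 1; 2; 3]%N.
    have [il2|il2] := eqVneq m l.-2; first by row [:: l; l.-1; l.-2; (l - 3)%N].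
    by row [:: m; m.-1; m.+1]%N.
  - have [->|m2] := eqVneq m 2%N; first by row [:: 0; 1; 2; 3]%N.
    by row [:: m; m.-1; m.+1]%N.
have H k : (k < top.-1)%N -> reach t (ones_upper t (top - k)).
  elim: k => [|k IH] kl; first by rewrite subn0.
  have E : (top - k = (top - k.+1).+1)%N by lia.
  have mk : mark0 t (top - k.+1) = 2%N.
    by move: kl; rewrite /top /mark0; case: (t) tv tp => //= l lv _ ?; rewrite ifF //; lia.
  apply: (reach_move (IH _) (i := (top - k.+1)%N) (r := 1)); try lia.
    by rewrite E step //; lia.
  move=> j jl; rewrite /ones_upper; have [->|] := eqVneq j (top - k.+1)%N.
    have m0 : (top - k.+1 == 0)%N = false by lia.
    by rewrite E; move: (top - k.+1)%N mk m0 => T -> ->; rewrite ltnn ltnSn.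
  rewrite E; move: (top - k.+1)%N => T jT; have [//|j0] := eqVneq j 0%N.
  by rewrite ltnS [(j <= T)%N]leq_eqVlt (negPf jT).
apply: reach_ext (H top.-2 _) _; first by lia.
move=> j jl; rewrite /highest /ones_upper; case: ifP => // j0; case: ifP => // j2.
have -> : j = 1%N by lia.
by case: (t) tp => //= l _; rewrite /mark0.
Qed.

(** A list keeps the coordinates evaluated after each letter of a word; nested functions would
    recompute them at every use. *)
Definition seq_reflect (t : affine_type) (i : nat) (s : seq int) : seq int :=
  let r := foldr (fun j z => cartan_entry t i j * nth 0 s j + z) 0
             (iota 0 (rank t).+1) in
  mkseq (fun j => nth 0 s j - (if j == i then r else 0)) (rank t).+1.

Lemma reach_word t j w : (0 < j <= rank t)%N -> all (fun i => 0 < i <= rank t)%N w ->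
  reach t (nth 0 (foldr (seq_reflect t) (mkseq (unit_coord j) (rank t).+1) w)).
Proof.
move=> /andP [j0 jr]; elim: w => [|i w IH] /=.
  move=> _; apply: reach_ext (reach_simple j0 jr) _ => k kr.
  by rewrite nth_mkseq.
move=> /andP [/andP [i0 ir] /IH {}IH].
apply: reach_ext (reach_step i0 ir IH) _ => k kr.
by rewrite /seq_reflect nth_mkseq // rowsum_foldr.
Qed.

(* The source node and the word, found by descending from the highest root. *)
Definition highest_word (t : affine_type) : nat * seq nat :=
  match t with
  | E6_1 => (6, [:: 6; 3; 2; 1; 4; 3; 2; 5; 4; 3])
  | E7_1 => (7, [:: 1; 2; 3; 4; 5; 6; 7; 3; 2; 1; 4; 3; 2; 5; 4; 3])
  | E8_1 => (8, [:: 1; 2; 3; 4; 5; 6; 7; 8; 5; 4; 3; 2; 1; 6; 5; 4; 3; 2; 8; 5;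
                    4; 3; 6; 5; 4; 7; 6; 5])
  | F4_1 | E6_2 => (2, [:: 1; 2; 3; 2; 1; 4; 3])
  | _ => (1, [:: 1; 2])
  end%N.

Lemma reach_highest t : valid_type t -> reach t (highest t).
Proof.
move=> tv.
have check : all (fun j => nth 0 (foldr (seq_reflect t)
      (mkseq (unit_coord (highest_word t).1) (rank t).+1) (highest_word t).2) j
      == highest t j) (iota 0 (rank t).+1) ->
    (0 < (highest_word t).1 <= rank t)%N ->
    all (fun i => 0 < i <= rank t)%N (highest_word t).2 -> reach t (highest t).
  move=> /allP H H1 H2; apply: reach_ext (reach_word H1 H2) _ => j jr.
  by have := H j; rewrite mem_iota add0n ltnS leq0n => /(_ jr) /eqP ->.
case: t tv check => [l|l|l|l|l|l|l|||||||] tv check;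
  try exact: reach_highest_path; try exact: reach_highest_fork.
all: by apply: check; vm_compute.
Qed.

(** * Generation of the lattice M *)

Definition dcoef0 (t : affine_type) (i : nat) : nat :=
  if untwisted t || is_A2even t then (mark0 t 0 * mark0 t i %/ comark0 t i)%N else 1%N.

(** Exactness of the quotient makes d_i alpha_i / a_0 equal to (a_i / a_i^vee) alpha_i, the image of
    the coroot h_i under the form. *)
Lemma dcoef0_exact t i : valid_type t -> untwisted t || is_A2even t ->
  (0 < i)%N -> (i <= rank t)%N -> (comark0 t i * dcoef0 t i = mark0 t 0 * mark0 t i)%N.
Proof.
rewrite /dcoef0 => tv E; rewrite E => i0 il.
rewrite muln_divA ?mulKn ?comark0_gt0 //.
apply/dvdnP; case: t tv E il => [l|l|l|l|l|l|l|||||||] //= lv _; rewrite /comark0 /mark0 => il.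
- by exists 1%N.
- by exists (if i == l then 2%N else 1%N); repeat (case: ifP => ? //); lia.
- by eexists; rewrite muln1.
- by exists 1%N.
- by exists (if i == l then 1%N else 2%N); repeat (case: ifP => ? //); lia.
all: apply/dvdnP; move: i0; apply/implyP; move: i il; concrete.
Qed.

Lemma dcoef0_dvd t i : valid_type t -> (0 < i)%N -> (i <= rank t)%N ->
  exists q, mark0 t i = (q * dcoef0 t i)%N.
Proof.
move=> tv i0 il; have := dcoef0_exact tv _ i0 il.
have [E|nE] := boolP (untwisted t || is_A2even t); last first.
  by move=> _; exists (mark0 t i); rewrite /dcoef0 (negPf nE) muln1.
move/(_ isT); case: t tv il E => [l|l|l|l|l|l|l|||||||] //= lv il _;
  try by move=> H; eexists; rewrite -[LHS]mul1n -H.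
(* Type [A2even], where a_0 = 2 is compensated by the comark 2 at every node other than 0. *)
have i00 : (i == 0%N) = false by lia.
have l0 : (0%N == l) = false by lia.
by rewrite /comark0 /mark0 /= i00 l0 => H; exists 1%N; lia.
Qed.

(** The difference of a vector and its reflection is a multiple of one simple root; this is how
    single generators are extracted from theta. *)
Lemma lattice_coroot t i x : (0 < i)%N -> (i <= rank t)%N -> orbit_lattice t x ->
  orbit_lattice t (fun j => rowsum t x i * unit_coord i j).
Proof.
move=> i0 ir xl; apply: lattice_ext (lattice_sub xl (lattice_reflect i0 ir xl)) _ => j jr.
by rewrite subKr /unit_coord; case: eqP => _; rewrite ?mulr1 ?mulr0.
Qed.

Lemma lattice_zero t : orbit_lattice t (fun => 0).
Proof.
apply: lattice_ext (lattice_sub (lattice_highest t) (lattice_highest t)) _ => j _.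
by rewrite subrr.
Qed.

Lemma lattice_opp t x : orbit_lattice t x -> orbit_lattice t (fun j => - x j).
Proof.
move=> xl; apply: lattice_ext (lattice_sub (lattice_zero t) xl) _ => j _.
by rewrite sub0r.
Qed.

Lemma rowsum_unit t i p d : (p <= rank t)%N ->
  rowsum t (fun j => d * unit_coord p j) i = cartan_entry t i p * d.
Proof.
move=> pr; rewrite (rowsum_supp (s := [:: p])) //= ?pr //; last first.
  by move=> j _; rewrite inE => /negPf jp; rewrite /unit_coord jp !mulr0.
by rewrite big_seq1 /unit_coord eqxx mulr1.
Qed.

Lemma lattice_add t x y : orbit_lattice t x -> orbit_lattice t y ->
  orbit_lattice t (fun j => x j + y j).
Proof.
move=> xl yl; apply: lattice_ext (lattice_sub xl (lattice_opp yl)) _ => j _.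
by rewrite opprK.
Qed.

Lemma lattice_muln t x (n : nat) : orbit_lattice t x ->
  orbit_lattice t (fun j => n%:Z * x j).
Proof.
move=> xl; elim: n => [|n IH].
  by apply: lattice_ext (lattice_zero t) _ => j _; rewrite mul0r.
apply: lattice_ext (lattice_add IH xl) _ => j _.
by rewrite -addn1 PoszD mulrDl mul1r.
Qed.

Definition coroot_coord (t : affine_type) (i : nat) : nat -> int :=
  fun j => (dcoef0 t i)%:Z * unit_coord i j.

(** Generators are passed from parent to child along the spanning tree: reflecting d_p alpha_p at
    [i] produces d_i alpha_i when a_ip d_p = -d_i. The children of node 0 start from theta, whose
    pairing with h_i is -a_i0 a_0. *)
Lemma lattice_spread t m : valid_type t -> (m <= rank t)%N ->
    (forall i, (0 < i <= m)%N ->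
       cartan_entry t i (parent t i) *
         (if parent t i == 0%N then mark0 t 0 else dcoef0 t (parent t i))%:Z
         = - (dcoef0 t i)%:Z /\ (parent t i <= m)%N) ->
  forall i, (0 < i <= m)%N -> orbit_lattice t (coroot_coord t i).
Proof.
move=> tv mr H i; have [n] := ubnP (depth t i); elim: n i => // n IH i lt im.
have [i0 il] := andP im; have ir := leq_trans il mr.
have /and3P [pr pd _] := parent_edge tv i0 ir.
have [Hi pm] := H i im.
have [p0|pn0] := eqVneq (parent t i) 0%N.
  rewrite p0 eqxx in Hi.
  have E : rowsum t (highest t) i = (dcoef0 t i)%:Z.
    have := mark0_row tv ir; rewrite /rowsum !big_ord_recl /= Hi => /eqP.
    rewrite addrC subr_eq0 => /eqP <-; rewrite /highest /= mulr0 add0r.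
    by apply: eq_bigr.
  apply: lattice_ext (lattice_coroot i0 ir (lattice_highest t)) _ => j _.
  by rewrite E.
rewrite (negPf pn0) in Hi.
have Lp : orbit_lattice t (coroot_coord t (parent t i)).
  by apply: IH; [lia | rewrite lt0n pn0].
apply: lattice_ext (lattice_opp (lattice_coroot i0 ir Lp)) _ => j _.
by rewrite /coroot_coord rowsum_unit // Hi mulNr opprK.
Qed.

(* The last node of a path need not be reachable by [lattice_spread]; there the
   highest root itself supplies the missing generator. *)
Lemma lattice_leaf t : valid_type t -> (0 < rank t)%N ->
    dcoef0 t (rank t) = mark0 t (rank t) ->
    (forall i, (0 < i < rank t)%N -> orbit_lattice t (coroot_coord t i)) ->
  orbit_lattice t (coroot_coord t (rank t)).
Proof.
move=> tv r0 E H.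
have part m : (m < rank t)%N ->
    orbit_lattice t (fun j => if (0 < j <= m)%N then (mark0 t j)%:Z else 0).
  elim: m => [|m IH] mr.
    by apply: lattice_ext (lattice_zero t) _ => j _; case: j.
  have [q qE] := dcoef0_dvd tv (ltn0Sn m) (ltnW mr).
  have Hm : orbit_lattice t (coroot_coord t m.+1) by apply: H; lia.
  apply: lattice_ext (lattice_add (IH (ltnW mr)) (lattice_muln q Hm)) _ => j _.
  rewrite /coroot_coord /unit_coord mulrA -PoszM -qE.
  have [->|jm] := eqVneq j m.+1.
    by rewrite ltnn andbF ltn0Sn leqnn add0r mulr1.
  by rewrite mulr0 addr0; have -> : (j <= m.+1)%N = (j <= m)%N by lia.
have mr : ((rank t).-1 < rank t)%N by lia.
apply: lattice_ext (lattice_sub (lattice_highest t) (part _ mr)) _ => j jr.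
rewrite /coroot_coord /highest /unit_coord.
have [->|jm] := eqVneq j (rank t).
  by rewrite !ifF ?subr0 ?mulr1 ?E //; lia.
rewrite mulr0; have [->|j0] := eqVneq j 0%N; first by [].
by rewrite ifT ?subrr //; lia.
Qed.

Lemma lattice_coroots_path t i : valid_type t ->
    match t with A1 l => l == 1%N | C1 _ | D2 _ | A2even _ => true | _ => false end ->
    (0 < i <= rank t)%N ->
  orbit_lattice t (coroot_coord t i).
Proof.
move=> tv tp; have r0 : (0 < rank t)%N by case: t tv tp => //= l; lia.
have low j : (0 < j <= (rank t).-1)%N -> orbit_lattice t (coroot_coord t j).
  apply: lattice_spread => // [|k]; first by lia.
  case: t tv tp {r0} => [l|l|l|l|l|l|l|||||||] //= tv tp kl.
  - by move/eqP: tp kl => ->; lia.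
  - split; last by lia.
    rewrite /dcoef0 /parent /comark0 /mark0 /=.
    by entries.
  - split; last by lia.
    by rewrite /dcoef0 /parent /comark0 /mark0 /=; entries.
  - have l1 : l != 1%N by lia.
    split; last by lia.
    by rewrite /dcoef0 /parent /comark0 /mark0 /=; entries.
move=> /andP [i0]; rewrite leq_eqVlt => /orP [/eqP ->|il]; last first.
  by apply: low; lia.
apply: lattice_leaf => // [|j jl]; last by apply: low; lia.
by case: t tv tp {r0 low i0} => [l|l|l|l|l|l|l|||||||] //= tv _;
  rewrite /dcoef0 /comark0 /mark0 /=; entries.
Qed.

Lemma lattice_coroots t i : valid_type t -> (0 < i <= rank t)%N ->
  orbit_lattice t (coroot_coord t i).
Proof.
move=> tv.
have [tp|tp] := boolP (match t with A1 l => l == 1%N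
  | C1 _ | D2 _ | A2even _ => true | _ => false end).
  exact: lattice_coroots_path.
move: i; apply: lattice_spread => //.
case: t tv tp => [l|l|l|l|l|l|l|||||||] //= tv tp i il.
- split; last by lia.
  by rewrite /dcoef0 /parent /comark0 /mark0 /=; entries.
- have [i1|i1] := eqVneq i 1%N.
    by split; [rewrite i1 /dcoef0 /parent /comark0 /mark0 /=; entries | lia].
  have [i2|i2] := eqVneq i 2%N.
    by split; [rewrite i2 /dcoef0 /parent /comark0 /mark0 /=; entries | lia].
  by split; [rewrite /dcoef0 /comark0 /mark0 /=; entries | lia].
- have [i3|i3] := eqVneq i l.
    by split; [rewrite /dcoef0 /comark0 /mark0 /=; entries | lia].
  have [i1|i1] := eqVneq i 1%N.
    by split; [rewrite /dcoef0 /comark0 /mark0 /=; entries | lia].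
  have [i2|i2] := eqVneq i 2%N.
    by split; [rewrite /dcoef0 /comark0 /mark0 /=; entries | lia].
  by split; [rewrite /dcoef0 /comark0 /mark0 /=; entries | lia].
- have [i1|i1] := eqVneq i 1%N.
    by split; [rewrite i1 /dcoef0 /parent /comark0 /mark0 /=; entries | lia].
  have [i2|i2] := eqVneq i 2%N.
    by split; [rewrite i2 /dcoef0 /parent /comark0 /mark0 /=; entries | lia].
  by split; [rewrite /dcoef0 /comark0 /mark0 /=; entries | lia].
all: have /andP [i0 ir] := il; clear il tp tv; split; [apply/eqP|].
all: by move: i0; apply/implyP; move: i ir; concrete.
Qed.

(** * Weyl group and translations *)

Section TypeMatrix.
Variables (t : affine_type).
Hypothesis tv : valid_type t.
Notation I := 'I_(rank t).+1.
Notation A := (cartan_matrix t).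

Lemma matrix_diag (i : I) : A i i = 2.
Proof. by rewrite mxE cartan_entry_diag. Qed.

Lemma matrix_off (i j : I) : i != j -> A i j <= 0.
Proof. by move=> ij; rewrite mxE cartan_entry_off. Qed.

Lemma matrix_sym (i j : I) :
  (comark0 t i)%:Z * (mark0 t j)%:Z * A i j = (comark0 t j)%:Z * (mark0 t i)%:Z * A j i.
Proof. by rewrite !mxE mark0_sym // -ltnS ltn_ord. Qed.

Lemma matrix_mark (i : I) : \sum_(j : I) A i j * (mark0 t j)%:Z = 0.
Proof.
have ir : (i <= rank t)%N by rewrite -ltnS.
rewrite -[RHS](mark0_row tv ir).
by apply: eq_bigr => j _; rewrite mxE.
Qed.

Lemma matrix_comark (j : I) : \sum_(i : I) (comark0 t i)%:Z * A i j = 0.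
Proof.
have mj : (mark0 t j)%:Z != 0.
  by have := @mark0_gt0 t j; rewrite -ltnS ltn_ord => /(_ isT); case: (mark0 t j).
apply: (mulIf mj); rewrite mul0r mulr_suml.
under eq_bigr do rewrite mulrAC matrix_sym -mulrA [X in _ * X]mulrC.
by rewrite -mulr_sumr matrix_mark mulr0.
Qed.

Lemma matrix_conn (Q : I -> Prop) : Q ord0 ->
  (forall i j, Q i -> A i j != 0 -> Q j) -> forall i, Q i.
Proof.
move=> Q0 QS i.
have H : forall k, (k <= rank t)%N -> Q (inord k).
  apply: diagram_connected => //.
    by have -> : inord 0 = ord0 :> I by apply/val_inj; rewrite /= inordK.
  by move=> j k jr kr Qj e; apply: QS Qj _; rewrite mxE !inordK.
by rewrite -(inord_val i); apply: H; rewrite -ltnS ltn_ord.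
Qed.

Lemma mark0_pos (i : I) : (0 < mark0 t i)%N.
Proof. by rewrite mark0_gt0 // -ltnS ltn_ord. Qed.

Lemma comark0_pos (i : I) : (0 < comark0 t i)%N.
Proof. by rewrite comark0_gt0 // -ltnS ltn_ord. Qed.

Lemma matrix_zero (i j : I) : A i j = 0 -> A j i = 0.
Proof.
move=> H; have := matrix_sym i j; rewrite H mulr0 => /esym/eqP.
by rewrite !mulf_eq0 !eqz_nat !gtn_eqF ?mark0_pos ?comark0_pos //= => /eqP.
Qed.

Lemma coprime_multiple (a b : I -> nat) (p : I) :
  (\big[gcdn/0]_(i < (rank t).+1) a i)%N = 1%N -> b p = 1%N ->
  (forall i, a i = a p * b i)%N -> forall i, a i = b i.
Proof.
move=> g bp H i; have ap : a p = 1%N.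
  apply/eqP; rewrite -dvdn1 -g; apply/dvdn_biggcdP => j _.
  by rewrite (H j) dvdn_mulr.
by rewrite (H i) ap mul1n.
Qed.

(** The kernel is a line, and comparison at a node where the table has entry one leaves an integral
    factor dividing a gcd equal to one. *)
Lemma marks_unique (a : I -> nat) : is_marks A a -> forall i, a i = mark0 t i.
Proof.
move=> [_ g Aa]; have [p pr mp] := mark0_unit tv.
have K := kernel_marks matrix_off mark0_pos comark0_pos matrix_mark
  matrix_sym matrix_conn (x := fun i => (a i)%:Z) Aa.
have pE : (inord p : I) = p :> nat by rewrite inordK.
apply: (coprime_multiple (p := inord p) g); rewrite ?pE // => i.
have : ratio (mark0 t) (fun i : I => (a i)%:Z) i
    = ratio (mark0 t) (fun i : I => (a i)%:Z) (inord p) by rewrite !K.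
rewrite /ratio pE mp divr1 => /(canRL (divfK _)); rewrite pnatr_eq0 -lt0n => /(_ (mark0_pos i)).
by rewrite -natrM => /eqP; rewrite eqr_nat => /eqP.
Qed.

(** The transposed kernel is reached through the same form: at z_i = c_i / a_i^vee it equals sum_j
    (sum_i c_i a_ij) a_j z_j = 0, so z is constant. *)
Lemma comarks_unique (c : I -> nat) : is_marks A^T c -> forall i, c i = comark0 t i.
Proof.
move=> [_ g cA].
pose z (i : I) : rat := (c i)%:R / (comark0 t i)%:R.
have cn (i : I) : (comark0 t i)%:R != 0 :> rat by rewrite pnatr_eq0 -lt0n comark0_pos.
have q0 : qform A (mark0 t) (comark0 t) z <= 0.
  rewrite /qform exchange_big big1 // => j _.
  under eq_bigr => i _.
    rewrite (_ : _ * _ = (A^T j i * (c i)%:Z)%:~R * ((mark0 t j)%:R * z j)); last first.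
      have -> : A^T j i = A i j by rewrite mxE.
      rewrite /fcoef /z !intrM -!pmulrn; field; exact/andP.
    over.
  by rewrite -mulr_suml -(rmorph_sum (intmul (1 : rat))) cA mul0r.
have K := qform_le0 matrix_off mark0_pos comark0_pos matrix_mark
  matrix_sym matrix_conn q0.
apply: (coprime_multiple (p := ord0) g); first exact: comark0_0.
move=> i; have := K i; rewrite /z (comark0_0 tv) divr1 => /(canRL (divfK (cn i))).
by rewrite -natrM => /eqP; rewrite eqr_nat => /eqP.
Qed.

End TypeMatrix.

Section WeylGroup.
Variables (C : numFieldType) (t : affine_type) (X : affine_datum C t).
Hypothesis tv : valid_type t.
Notation I := 'I_(rank t).+1.
Notation A := (cartan_matrix t).
Notation al := (simple_root X).
Notation hc := (simple_coroot X).
Notation B := (@inv_form C t X).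
Notation delta := (null_root X).

Lemma markE i : mark X i = mark0 t i.
Proof. exact: (marks_unique tv (markP X)). Qed.

Lemma comarkE i : comark X i = comark0 t i.
Proof. exact: (comarks_unique tv (comarkP X)). Qed.

Lemma mark_neq0 i : (mark X i)%:R != 0 :> C.
Proof. by rewrite markE pnatr_eq0 -lt0n mark0_pos. Qed.

Lemma comark_neq0 i : (comark X i)%:R != 0 :> C.
Proof. by rewrite comarkE pnatr_eq0 -lt0n comark0_pos. Qed.

Lemma formDr x y z : B x (y + z) = B x y + B x z.
Proof. by have := inv_form_scalar x 1 y z; rewrite scale1r mul1r. Qed.

Lemma form0r x : B x 0 = 0.
Proof. by apply: (addrI (B x 0)); rewrite -formDr !addr0. Qed.

Lemma formZr x a y : B x (a *: y) = a * B x y.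
Proof. by have := inv_form_scalar x a y 0; rewrite form0r !addr0. Qed.

Lemma formNr x y : B x (- y) = - B x y.
Proof. by rewrite -scaleN1r formZr mulN1r. Qed.

Lemma formDl x y z : B (y + z) x = B y x + B z x.
Proof. by rewrite !(inv_formC _ x) formDr. Qed.

Lemma formZl x a y : B (a *: y) x = a * B y x.
Proof. by rewrite !(inv_formC _ x) formZr. Qed.

Lemma formNl x y : B (- y) x = - B y x.
Proof. by rewrite !(inv_formC _ x) formNr. Qed.

Lemma form_suml (J : finType) (F : J -> weight X) x :
  B (\sum_j F j) x = \sum_j B (F j) x.
Proof.
apply: (big_morph (fun y => B y x)) => [y z|]; first exact: formDl.
by rewrite inv_formC form0r.
Qed.

Lemma levelD (x y : weight X) : level (x + y) = level x + level y.
Proof. by rewrite /level lfunE. Qed.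

Lemma levelZ a (x : weight X) : level (a *: x) = a * level x.
Proof. by rewrite /level lfunE. Qed.

Lemma levelE (x : weight X) : level x = \sum_i (comark X i)%:R * x (hc i).
Proof.
rewrite /level linear_sum; apply: eq_bigr => i _.
by rewrite linearMn mulr_natl.
Qed.

(** The null root corresponds to the canonical central element under the form. *)
Lemma form_delta x : B delta x = level x.
Proof.
rewrite /null_root form_suml levelE; apply: eq_bigr => i _.
rewrite -scaler_nat formZl inv_form_root mulrA; congr (_ * _).
by rewrite mulrC divfK // mark_neq0.
Qed.

Lemma level_root i : level (al i) = 0.
Proof.
rewrite levelE; under eq_bigr => j _ do rewrite pairing_entry.
rewrite -[RHS](_ : (\sum_(j : I) (comark0 t j)%:Z * A j i)%:~R = 0); last first.
  by rewrite matrix_comark.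
rewrite (rmorph_sum (intmul (1 : C))); apply: eq_bigr => j _.
by rewrite /= intrM comarkE.
Qed.

Lemma level_sum_roots (c : I -> C) : level (\sum_i c i *: al i) = 0.
Proof.
have level0 : level (0 : weight X) = 0 by rewrite /level lfunE.
rewrite (big_morph (fun x : weight X => level x) levelD level0).
by rewrite big1 // => i _; rewrite levelZ level_root mulr0.
Qed.

Lemma delta_sum : delta = \sum_i (mark X i)%:R *: al i.
Proof. by apply: eq_bigr => i _; rewrite scaler_nat. Qed.

Lemma level_delta : level delta = 0.
Proof. by rewrite delta_sum level_sum_roots. Qed.

Lemma delta_coroot i : delta (hc i) = 0.
Proof.
have := form_delta (al i); rewrite level_root inv_formC inv_form_root => /eqP.
rewrite mulf_eq0 mulf_eq0 invr_eq0 (negPf (comark_neq0 i)) (negPf (mark_neq0 i)) /=.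
by move/eqP.
Qed.

Lemma root_coroot i : al i (hc i) = 2.
Proof. by rewrite pairing_entry matrix_diag. Qed.

Lemma reflectionD i (x y : weight X) : reflection i (x + y) = reflection i x + reflection i y.
Proof. by rewrite /reflection lfunE scalerDl opprD addrACA. Qed.

Lemma reflectionZ i a (x : weight X) : reflection i (a *: x) = a *: reflection i x.
Proof. by rewrite /reflection lfunE scalerBr scalerA. Qed.

Lemma reflectionK i : involutive (reflection (X := X) i).
Proof.
move=> x; rewrite {1}/reflection /reflection !lfunE /= !lfunE /= !lfunE /= root_coroot.
rewrite -addrA -opprD -scalerDl.
have -> : x (hc i) + (x (hc i) - x (hc i) * 2) = 0 by ring.
by rewrite scale0r subr0.
Qed.

Lemma reflection_delta i : reflection i delta = delta.
Proof. by rewrite /reflection delta_coroot scale0r subr0. Qed.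

Lemma level_reflection i (x : weight X) : level (reflection i x) = level x.
Proof. by rewrite /reflection -scaleNr levelD levelZ level_root mulr0 addr0. Qed.

Lemma form_reflection i (x y : weight X) : B (reflection i x) (reflection i y) = B x y.
Proof.
rewrite /reflection -!scaleNr !formDl !formDr !formZl !formZr.
rewrite [B x (al i)]inv_formC !inv_form_root root_coroot; ring.
Qed.

Definition weyl (s : seq I) : weight X -> weight X :=
  foldr (fun i f => reflection i \o f) id s.

Lemma weyl_cat s1 s2 x : weyl (s1 ++ s2) x = weyl s1 (weyl s2 x).
Proof. by elim: s1 => //= i s1 ->. Qed.

Lemma weyl_revK s x : weyl (rev s) (weyl s x) = x.
Proof.
elim: s x => //= i s IH x.
by rewrite rev_cons -cats1 weyl_cat /= reflectionK IH.
Qed.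

Lemma weylKrev s x : weyl s (weyl (rev s) x) = x.
Proof. by rewrite -{1}(revK s) weyl_revK. Qed.

Lemma weylD s x y : weyl s (x + y) = weyl s x + weyl s y.
Proof. by elim: s => //= i s ->; rewrite reflectionD. Qed.

Lemma weylZ s a x : weyl s (a *: x) = a *: weyl s x.
Proof. by elim: s => //= i s ->; rewrite reflectionZ. Qed.

Lemma weyl_delta s : weyl s delta = delta.
Proof. by elim: s => //= i s ->; rewrite reflection_delta. Qed.

Lemma level_weyl s x : level (weyl s x) = level x.
Proof. by elim: s => //= i s IH; rewrite level_reflection. Qed.

Lemma form_weyl s x y : B (weyl s x) (weyl s y) = B x y.
Proof. by elim: s => //= i s IH; rewrite form_reflection. Qed.

Lemma translD (a b x : weight X) : level a = 0 -> level b = 0 ->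
  translation a (translation b x) = translation (a + b) x.
Proof.
move=> a0 b0; rewrite /translation.
set u := x + level x *: b; set r := B x b + _.
have lu : level (u - r *: delta) = level x.
  by rewrite /u -scaleNr !levelD !levelZ b0 level_delta !mulr0 !addr0.
have fB : B (u - r *: delta) a = B x a + level x * B b a.
  by rewrite formDl formNl formZl form_delta a0 mulr0 subr0 formDl formZl.
rewrite lu fB scalerDr /u -!addrA; congr (x + _).
rewrite [RHS]addrCA; congr (_ + _).
rewrite [LHS]addrCA; congr (_ + _).
rewrite -!scaleNr -scalerDl; congr (_ *: _).
by rewrite /r !formDl !formDr [B b a]inv_formC; field.
Qed.

Lemma transl0 (x : weight X) : translation 0 x = x.
Proof. by rewrite /translation scaler0 addr0 !form0r mul0r mul0r addr0 scale0r subr0. Qed.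

Lemma transl_weyl s (a x : weight X) : weyl s (translation a x) = translation (weyl s a) (weyl s x).
Proof.
rewrite /translation -!scaleNr !weylD !weylZ weyl_delta level_weyl.
by rewrite !form_weyl.
Qed.

Definition vec (x : nat -> int) : weight X := \sum_(i : I) (x i)%:~R *: al i.

Lemma vec_ext x y : (forall j, (j <= rank t)%N -> y j = x j) -> vec y = vec x.
Proof. by move=> H; apply: eq_bigr => i _; rewrite H // -ltnS. Qed.

Lemma level_vec x : level (vec x) = 0.
Proof. exact: level_sum_roots. Qed.

Lemma vec_coroot x (i : I) : vec x (hc i) = (rowsum t x i)%:~R.
Proof.
rewrite /vec sum_lfunE (rmorph_sum (intmul (1 : C))); apply: eq_bigr => j _.
by rewrite lfunE /= pairing_entry mxE intrM mulrC.
Qed.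

Lemma vec_reflect x (i : I) :
  vec (fun j => x j - (if j == i :> nat then rowsum t x i else 0)) = reflection i (vec x).
Proof.
rewrite /reflection vec_coroot /vec.
under eq_bigr => j _ do rewrite intrB scalerBl.
rewrite sumrB; congr (_ - _); rewrite (bigD1 i) //= eqxx big1 ?addr0 // => j ji.
by rewrite (_ : (j == i :> nat) = false) ?scale0r //; apply: negPf.
Qed.

Definition refl_vec (g x : weight X) : weight X := x - (2 * B g x / B g g) *: g.

Definition finite_word (s : seq 'I_(rank t)) : seq I := map (lift ord0) s.

Lemma lift_of i : (0 < i)%N -> (i <= rank t)%N ->
  exists i' : 'I_(rank t), lift ord0 i' = i :> nat.
Proof.
move=> i0 ir; have H : (i.-1 < rank t)%N by rewrite prednK.
by exists (Ordinal H); rewrite /= /bump leq0n add1n prednK.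
Qed.

(** The reflection in w(alpha_i) is w s_i w^(-1), so it stays in the finite Weyl group. *)
Lemma reach_refl x : reach t x -> B (vec x) (vec x) != 0 /\
  exists s, forall y, refl_vec (vec x) y = weyl (finite_word s) y.
Proof.
elim=> [i i0 ir|i {}x i0 ir _ [n0 [s Hs]]|{}x y _ [n0 [s Hs]] H]; last first.
- by rewrite (vec_ext H); split=> //; exists s.
- have [i' E] := lift_of i0 ir; rewrite -E vec_reflect.
  split; first by rewrite form_reflection.
  exists (i' :: s ++ [:: i']) => y; rewrite /finite_word /= map_cat weyl_cat /=.
  rewrite -Hs /refl_vec -!scaleNr reflectionD reflectionZ reflectionK form_reflection.
  by rewrite -{2}[y](reflectionK (lift ord0 i')) form_reflection.
have [i' E] := lift_of i0 ir.
have -> : vec (unit_coord i) = al (lift ord0 i').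
  rewrite /vec (bigD1 (lift ord0 i')) //= -E /unit_coord eqxx scale1r big1 ?addr0 // => j ji.
  by rewrite (_ : (j == lift ord0 i' :> nat) = false) ?scale0r //; apply: negPf.
set k := lift ord0 i'.
have n0 : B (al k) (al k) != 0.
  rewrite inv_form_root root_coroot !mulf_neq0 ?invr_eq0 ?mark_neq0 ?comark_neq0 //.
  by rewrite pnatr_eq0.
split=> //; exists [:: i'] => y.
have cE : 2 * B (al k) y / B (al k) (al k) = y (hc k).
  rewrite !inv_form_root root_coroot; field.
  by rewrite mark_neq0 comark_neq0.
by rewrite /refl_vec cE.
Qed.

Lemma comark_ord0 : comark X ord0 = 1%N.
Proof. by rewrite comarkE comark0_0. Qed.

Lemma vec_highest : vec (highest t) = delta - (mark X ord0)%:R *: al ord0.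
Proof.
rewrite /vec delta_sum big_ord_recl [in RHS]big_ord_recl /= scale0r add0r addrAC subrr add0r.
by apply: eq_bigr => i _; rewrite markE.
Qed.

Notation a0 := ((mark X ord0)%:R : C).

Lemma form_highest : B (vec (highest t)) (vec (highest t)) = 2 * a0.
Proof.
rewrite vec_highest -scaleNr !formDl !formDr !formZl !formZr !form_delta level_delta.
rewrite level_root [B (al _) delta]inv_formC form_delta level_root.
rewrite inv_form_root root_coroot comark_ord0; field; exact: mark_neq0.
Qed.

(** Since the comark at node 0 is one, pairing with h_0 is the level minus the pairing with theta;
    together with alpha_0 = (delta - theta) / a_0 this lets both sides be expanded in theta and
    delta. *)
Lemma translation_highest x :
  translation (a0^-1 *: vec (highest t)) x = reflection ord0 (refl_vec (vec (highest t)) x).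
Proof.
pose th := vec (highest t).
have [n0 _] := reach_refl (reach_highest tv).
have thE : th = delta - a0 *: al ord0 := vec_highest.
have a00 : a0 != 0 := mark_neq0 ord0.
have cE : 2 * B th x / B th th = B th x / a0.
  by rewrite /th form_highest; field.
have pE (y : weight X) : y (hc ord0) = level y - B th y.
  rewrite thE formDl formNl formZl form_delta inv_form_root comark_ord0.
  by field.
have alE : al ord0 = a0^-1 *: (delta - th).
  by rewrite thE opprB addrC subrK scalerA mulVf // scale1r.
have lth : level th = 0 := level_vec _.
pose y := x - (B th x / a0) *: th.
have ly : level y = level x.
  by rewrite /y -scaleNr levelD levelZ lth mulr0 addr0.
have By : B th y = - B th x.
  by rewrite /y formDr formNr formZr /th form_highest; field.
have rE : reflection ord0 (refl_vec th x) = y - (level x + B th x) *: (a0^-1 *: (delta - th)).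
  by rewrite /refl_vec cE -/y /reflection pE ly By opprK -alE.
have tE : translation (a0^-1 *: th) x =
    x + (level x / a0) *: th - ((level x + B th x) / a0) *: delta.
  rewrite /translation scalerA formZr formZl formZr [B x th]inv_formC.
  have -> : B th th = 2 * a0 by exact: form_highest.
  have -> // : a0^-1 * B th x + a0^-1 * (a0^-1 * (2 * a0)) * level x / 2 =
    (level x + B th x) / a0 by field.
rewrite -/th tE rE scalerA scalerBr opprB /y.
have -> : level x / a0 = (level x + B th x) / a0 - B th x / a0 by field.
by rewrite scalerBl addrA [x + _]addrC [RHS]addrA; congr (_ - _); rewrite addrC addrA addrAC.
Qed.

End WeylGroup.

(** * Translations by M inside the Weyl group *)

Section TranslationSubgroup.
Variables (C : numFieldType) (t : affine_type) (X : affine_datum C t).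
Hypothesis tv : valid_type t.
Notation I := 'I_(rank t).+1.
Notation A := (cartan_matrix t).
Notation al := (simple_root X).
Notation hc := (simple_coroot X).
Notation B := (@inv_form C t X).
Notation delta := (null_root X).
Notation a0 := ((mark X ord0)%:R : C).
Notation M := (lattice_M X).

(** The level is recorded because the additivity of translations in [translD] is stated for vectors
    of level zero. *)
Definition translation_in_weyl (a : weight X) : Prop :=
  level a = 0 /\ exists s, forall y : weight X, translation a y = weyl s y.

Lemma tiw_sub a b : translation_in_weyl a -> translation_in_weyl b ->
  translation_in_weyl (a - b).
Proof.
move=> [la [s Hs]] [lb [r Hr]].
have lnb : level (- b) = 0 by rewrite -scaleN1r levelZ lb mulr0.
split; first by rewrite levelD la lnb addr0.
exists (s ++ rev r) => y; rewrite weyl_cat -Hs -translD //.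
congr translation.
by rewrite -[LHS](weyl_revK r) -Hr translD // subrr transl0.
Qed.

Lemma tiw_zero : translation_in_weyl 0.
Proof.
split; first by rewrite -(scale0r (0 : weight X)) levelZ mul0r.
by exists [::] => y; rewrite transl0.
Qed.

Lemma tiw_add a b : translation_in_weyl a -> translation_in_weyl b ->
  translation_in_weyl (a + b).
Proof.
move=> Ha Hb; rewrite -[b]opprK -[- b]sub0r.
by do 2!apply: tiw_sub => //; apply: tiw_zero.
Qed.

Lemma tiw_mulz a (z : int) : translation_in_weyl a -> translation_in_weyl (a *~ z).
Proof.
move=> Ha; have nat n : translation_in_weyl (a *+ n).
  by elim: n => [|n IH]; [apply: tiw_zero | rewrite mulrSr; apply: tiw_add].
case: z => n; first exact: nat.
rewrite NegzE mulrNz -[- _]sub0r; apply: tiw_sub; [exact: tiw_zero | exact: nat].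
Qed.

Lemma tiw_weyl s a : translation_in_weyl a -> translation_in_weyl (weyl s a).
Proof.
move=> [la [r Hr]]; split; first by rewrite level_weyl.
exists (s ++ r ++ rev s) => y.
by rewrite !weyl_cat -Hr transl_weyl // weylKrev.
Qed.

Lemma vec_sub (x y : nat -> int) : vec X (fun j => x j - y j) = vec X x - vec X y.
Proof. by rewrite /vec -sumrB; apply: eq_bigr => i _; rewrite intrB scalerBl. Qed.

(** The vectors whose translations lie in W form a group, stable under W because conjugation by w
    moves t_a to t_(w a). *)
Lemma orbit_lattice_tiw x : orbit_lattice t x -> translation_in_weyl (a0^-1 *: vec X x).
Proof.
elim=> [|{}x y _ IHx _ IHy|i {}x i0 ir _ IH|{}x y _ IH H].
- split; first by rewrite levelZ level_vec // mulr0.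
  have [_ [s Hs]] := reach_refl X tv (reach_highest tv).
  by exists (ord0 :: finite_word s) => y; rewrite translation_highest // Hs.
- by rewrite vec_sub scalerBr; apply: tiw_sub.
- have [i' E] := lift_of i0 ir; rewrite -E vec_reflect //.
  by rewrite -reflectionZ; apply: (tiw_weyl [:: lift ord0 i'] IH).
- by rewrite (vec_ext X H).
Qed.

Lemma dcoefE (i : 'I_(rank t)) : dcoef X i = dcoef0 t (lift ord0 i).
Proof. by rewrite /dcoef /dcoef0 !(markE X tv) (comarkE X tv). Qed.

Definition coroot_gen (i : 'I_(rank t)) : weight X :=
  ((dcoef X i)%:R / a0) *: al (lift ord0 i).

Lemma lift_bounds (i : 'I_(rank t)) : (0 < (lift ord0 i : nat) <= rank t)%N.
Proof. by rewrite lift0 /=. Qed.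

Lemma vec_unit d (k : I) : vec X (fun j => d * unit_coord k j) = d%:~R *: al k.
Proof.
rewrite /vec (bigD1 k) //= /unit_coord eqxx mulr1 big1 ?addr0 // => j jk.
by rewrite (_ : (j == k :> nat) = false) ?mulr0 ?scale0r //; apply: negPf.
Qed.

Lemma gen_tiw i : translation_in_weyl (coroot_gen i).
Proof.
have := orbit_lattice_tiw (lattice_coroots tv (lift_bounds i)).
by rewrite /coroot_coord vec_unit scalerA mulrC /coroot_gen dcoefE.
Qed.

Lemma lattice_tiw a : M a -> translation_in_weyl a.
Proof.
move=> [z ->]; apply: (big_ind translation_in_weyl).
- exact: tiw_zero.
- exact: tiw_add.
- by move=> i _; apply: tiw_mulz; apply: gen_tiw.
Qed.

Lemma latticeD a b : M a -> M b -> M (a + b).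
Proof.
move=> [z ->] [z' ->]; exists (fun i => z i + z' i).
by rewrite -big_split; apply: eq_bigr => i _; rewrite /= mulrzDr.
Qed.

Lemma latticeMz a (k : int) : M a -> M (a *~ k).
Proof.
move=> [z ->]; exists (fun i => z i * k).
by rewrite mulrz_suml; apply: eq_bigr => i _; rewrite mulrzA.
Qed.

Lemma latticeN a : M a -> M (- a).
Proof. by move/(latticeMz (-1)); rewrite mulrN1z. Qed.

Lemma lattice0 : M 0.
Proof. by exists (fun _ => 0); rewrite big1. Qed.

Lemma lattice_gen i : M (coroot_gen i).
Proof.
exists (fun j => (j == i)%:Z); rewrite (bigD1 i) //= eqxx mulr1z big1 ?addr0 // => j ji.
by rewrite (negPf ji).
Qed.

Lemma lattice_sum (F : 'I_(rank t) -> weight X) : (forall i, M (F i)) -> M (\sum_i F i).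
Proof. by move=> H; apply: (big_ind M) => //; [apply: lattice0 | apply: latticeD]. Qed.

(** The integrality that makes M stable under s_i. In the coroot case the symmetry of the form turns
    d_j a_ij into a_ji d_i; in the remaining types all d_i are one. *)
Lemma gen_integral (i j : 'I_(rank t)) : exists q : int,
  (dcoef X j)%:Z * A (lift ord0 i) (lift ord0 j) = q * (dcoef X i)%:Z.
Proof.
rewrite !dcoefE.
have [E|nE] := boolP (untwisted t || is_A2even t); last first.
  by eexists; rewrite {2}/dcoef0 (negPf nE) mulr1.
exists (A (lift ord0 j) (lift ord0 i)).
have := matrix_sym tv (lift ord0 i) (lift ord0 j).
have /andP [i0 ir] := lift_bounds i; have /andP [j0 jr] := lift_bounds j.
have := dcoef0_exact tv E i0 ir; have := dcoef0_exact tv E j0 jr.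
have := comark0_gt0 ir; have := comark0_gt0 jr; have := mark0_gt0 (leq0n (rank t)).
move: (comark0 t _) (comark0 t _) (mark0 t _) (mark0 t _) (mark0 t _) (dcoef0 t _) (dcoef0 t _).
move: (A _ _) (A _ _) => y x c1 c2 m0 m1 m2 d1 d2 m00 c10 c20 e1 e2 s.
have {}e1 : c2%:Z * d2%:Z = m2%:Z * m1%:Z by rewrite -!PoszM e1.
have {}e2 : c1%:Z * d1%:Z = m2%:Z * m0%:Z by rewrite -!PoszM e2.
have n0 : c1%:Z * c2%:Z != 0 by rewrite mulf_neq0 // eqz_nat -lt0n.
apply: (mulfI n0).
have -> : c1%:Z * c2%:Z * (d2%:Z * x) = m2%:Z * (c1%:Z * m1%:Z * x).
  transitivity (c1%:Z * (c2%:Z * d2%:Z) * x); first by ring.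
  by rewrite e1; ring.
rewrite s.
have -> : c1%:Z * c2%:Z * (y * d1%:Z) = c2%:Z * (c1%:Z * d1%:Z) * y by ring.
by rewrite e2; ring.
Qed.

Lemma lattice_reflection (i : 'I_(rank t)) a : M a -> M (reflection (lift ord0 i) a).
Proof.
move=> [z ->]; rewrite (big_morph (reflection (lift ord0 i))
  (reflectionD (X := X) (lift ord0 i)) (id1 := 0) (id2 := 0)); last first.
  by rewrite /reflection lfunE scale0r subr0.
apply: lattice_sum => j; have [q Hq] := gen_integral i j.
have -> : reflection (lift ord0 i) (coroot_gen j *~ z j) =
    coroot_gen j *~ z j - coroot_gen i *~ (q * z j).
  have cE : (coroot_gen j *~ z j) (hc (lift ord0 i)) =
      (q * z j)%:~R * ((dcoef X i)%:R / a0).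
    rewrite -scaler_int lfunE /= /coroot_gen lfunE /= pairing_entry.
    rewrite -[LHS]/((z j)%:~R * ((dcoef X j)%:R / a0 * (A (lift ord0 i) (lift ord0 j))%:~R)).
    have -> : (dcoef X j)%:R / a0 * (A (lift ord0 i) (lift ord0 j))%:~R
        = ((dcoef X j)%:Z * A (lift ord0 i) (lift ord0 j))%:~R / a0.
      by rewrite intrM mulrAC.
    by rewrite Hq !intrM; ring.
  by rewrite /reflection cE -[coroot_gen i *~ _]scaler_int {3}/coroot_gen scalerA.
apply: latticeD; first by apply: latticeMz; apply: lattice_gen.
by apply/latticeN/latticeMz/lattice_gen.
Qed.

Lemma lattice_finite (s : seq 'I_(rank t)) a : M a -> M (weyl (finite_word s) a).
Proof. by elim: s => //= i s IH Ma; apply: lattice_reflection; apply: IH. Qed.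

Lemma lattice_highest_root : M (a0^-1 *: vec X (highest t)).
Proof.
have -> : a0^-1 *: vec X (highest t) =
    \sum_(i < rank t) ((mark0 t (lift ord0 i))%:R / a0) *: al (lift ord0 i).
  rewrite /vec big_ord_recl scale0r add0r scaler_sumr; apply: eq_bigr => i _.
  by rewrite scalerA mulrC.
apply: lattice_sum => i; have /andP [i0 ir] := lift_bounds i.
have [q ->] := dcoef0_dvd tv i0 ir.
have -> : ((q * dcoef0 t (lift ord0 i))%:R / a0) *: al (lift ord0 i) = coroot_gen i *~ q.
  by rewrite -scaler_int /coroot_gen scalerA dcoefE natrM mulrA.
exact/latticeMz/lattice_gen.
Qed.

(* Besides the normality of T this needs only that the reflection in alpha_0 is
   the reflection in theta followed by the translation by theta / a_0. *)
Lemma weyl_decomposition (s : seq I) : exists a r, [/\ M a &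
  forall y : weight X, weyl s y = translation a (weyl (finite_word r) y)].
Proof.
elim: s => [|i s [a [r [Ma H]]]].
  by exists 0, [::]; split; [exact: lattice0 | move=> y; rewrite transl0].
have [la _] := lattice_tiw Ma.
case: (unliftP ord0 i) => [i'|] ->.
  exists (reflection (lift ord0 i') a), (i' :: r); split; first exact: lattice_reflection.
  by move=> y; rewrite /= H; apply: (transl_weyl tv [:: lift ord0 i']).
have [_ [u Hu]] := reach_refl X tv (reach_highest tv).
pose b := a0^-1 *: vec X (highest t).
have Mb : M b := lattice_highest_root.
have [lb _] := lattice_tiw Mb.
have Eb y : reflection ord0 y = translation b (weyl (finite_word (rev u)) y) :> weight X.
  rewrite /b translation_highest // Hu; congr reflection.
  by rewrite /finite_word map_rev weylKrev.
exists (b + weyl (finite_word (rev u)) a), (rev u ++ r); split.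
  by apply: latticeD => //; apply: lattice_finite.
move=> y; rewrite /= H Eb transl_weyl // translD ?level_weyl //.
by rewrite /finite_word map_cat weyl_cat.
Qed.

End TranslationSubgroup.

(** * The set of weights *)

Section WeightSet.
Variables (C : numFieldType) (t : affine_type) (X : affine_datum C t) (g : kac_moody X).
Hypothesis tv : valid_type t.
Notation I := 'I_(rank t).+1.
Notation A := (cartan_matrix t).
Notation al := (simple_root X).
Notation hc := (simple_coroot X).
Notation delta := (null_root X).
Variables (Lam : weight X) (k : nat) (V : lie_module g).
Hypothesis Lam_dom : dominant_integral Lam.
Hypothesis k_gt0 : (0 < k)%N.
Hypothesis Lam_level : level Lam = k%:R.
Hypothesis V_irr : is_irr_highest_weight V Lam.
Notation P := (weights V).
Notation eta := (eta_of Lam).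

(** The labels of Lam, given as elements of the ground field, are turned into the integers that the
    descent arguments require. *)
Lemma labels_exist : exists L : I -> int,
  [/\ forall i, 0 <= L i, forall i, Lam (hc i) = (L i)%:~R
    & \sum_(i : I) (comark0 t i)%:Z * L i = k%:Z].
Proof.
have [f Hf] := choice Lam_dom; exists (fun i => (f i)%:Z); split=> //.
apply/eqP; rewrite -(@eqr_int C) (rmorph_sum (intmul (1 : C))) -[X in _ == X]Lam_level.
rewrite levelE; apply/eqP; apply: eq_bigr => i _.
by rewrite /= intrM comarkE // Hf.
Qed.

Lemma eta_inj b b' : eta b = eta b' -> forall i, b i = b' i.
Proof.
move=> /addrI /oppr_inj H i; apply/eqP; rewrite -subr_eq0; apply/eqP.
apply: (roots_indepz (X := X) (c := fun i : I => b i - b' i)).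
under eq_bigr => j _ do rewrite mulrzBr.
by rewrite sumrB H subrr.
Qed.

Lemma level_eta b : level (eta b) = k%:R.
Proof.
rewrite /eta_of -scaleN1r levelD levelZ.
have -> : \sum_i al i *~ b i = \sum_i (b i)%:~R *: al i.
  by apply: eq_bigr => i _; rewrite scaler_int.
by rewrite level_sum_roots // mulr0 addr0.
Qed.

Lemma eta_add_delta b (z : int) : eta b + delta *~ z = eta (fun i : I => b i - z * (mark0 t i)%:Z).
Proof.
rewrite /eta_of -addrA; congr (_ + _); rewrite /null_root mulrz_suml -sumrN -big_split -sumrN.
apply: eq_bigr => i _ /=; rewrite mulrzBr opprB addrC; congr (_ - _).
by rewrite markE // pmulrn -mulrzA mulrC.
Qed.

Lemma weights_eta mu : P mu -> exists2 b, mu = eta b & forall i, 0 <= b i.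
Proof.
move=> /(weights_below V_irr) [s ->]; exists (fun i => (count_mem i s)%:Z) => //.
by rewrite /eta_of root_sumE.
Qed.

Lemma weights_eta_ge0 b : P (eta b) -> forall i, 0 <= b i.
Proof. by move=> /weights_eta [b' /eta_inj H H' i]; rewrite H. Qed.

Section Labels.
Variable L : I -> int.
Hypothesis L_ge0 : forall i, 0 <= L i.
Hypothesis LamL : forall i, Lam (hc i) = (L i)%:~R.
Hypothesis L_level : \sum_(i : I) (comark0 t i)%:Z * L i = k%:Z.

Lemma eta_coroot b i : eta b (hc i) = (pairing A L b i)%:~R.
Proof.
rewrite /eta_of lfunE /= lfunE /= LamL /pairing intrB; congr (_ - _).
rewrite sum_lfunE (rmorph_sum (intmul (1 : C))); apply: eq_bigr => j _ /=.
by rewrite -scaler_int lfunE /= pairing_entry -[LHS]/(_ * _) intrM mulrC.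
Qed.

Lemma reflection_eta i b : reflection i (eta b) = eta (reflect_coord A L i b).
Proof.
rewrite /reflection eta_coroot /eta_of /reflect_coord scaler_int -addrA -opprD.
congr (_ - _); under [RHS]eq_bigr => j _ do rewrite mulrzDr.
rewrite big_split /=; congr (_ + _).
by rewrite (bigD1 i) //= eqxx big1 ?addr0 // => j /negPf ->.
Qed.

Lemma weights_reflection i mu : P mu -> P (reflection i mu).
Proof.
move=> Pmu; have [b E _] := weights_eta Pmu.
rewrite /reflection {2}E eta_coroot scaler_int.
apply: (weights_string (@matrix_diag t) (@matrix_off t) (matrix_zero tv) Lam_dom V_irr Pmu).
  by rewrite E eta_coroot.
by rewrite lexx !andbT; case: (lerP 0 (pairing A L b i)) => //= /ltW ->.
Qed.

Lemma weights_weyl s mu : P mu -> P (weyl s mu).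
Proof. by elim: s => //= i s IH /IH; apply: weights_reflection. Qed.

Lemma level_pos : 0 < \sum_(i : I) (comark0 t i)%:Z * L i.
Proof. by rewrite L_level. Qed.

(** Simple roots are subtracted from Lam one at a time, always at a node where the pairing is
    positive and [b] is not yet reached; [weights_string] keeps each step inside the weights, and
    [dominant_unstuck] rules out stopping early. *)
Lemma dominant_weights b : (forall i, 0 <= b i) ->
  (forall i, 0 <= pairing A L b i) -> P (eta b).
Proof.
move=> b0 dom.
have H N b' : (forall i, b' i <= b i) -> P (eta b') ->
    (`|(\sum_i (b i - b' i))%R| < N)%N -> P (eta b).
  elim: N b' => // N IH b' le Pb' lt.
  have [/existsP [i /andP [bi pi]]|] :=
      boolP [exists i, (b' i < b i) && (0 < pairing A L b' i)].
    pose b'' j := b' j + (j == i)%:Z.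
    have E : eta b'' = eta b' - al i *~ 1.
      rewrite /eta_of /b'' -addrA -opprD mulr1z; congr (_ - _).
      under eq_bigr => j _ do rewrite mulrzDr.
      rewrite big_split /=; congr (_ + _).
      by rewrite (bigD1 i) //= eqxx big1 ?addr0 // => j /negPf ->.
    have le'' j : b'' j <= b j.
      by rewrite /b''; have := le j; case: eqP => [->|] /=; lia.
    apply: (IH b'' le'').
      rewrite E; apply: (weights_string (@matrix_diag t) (@matrix_off t)
        (matrix_zero tv) Lam_dom V_irr Pb' (eta_coroot b' i)).
      by apply/orP; left; lia.
    have S : \sum_j (b j - b'' j) = \sum_j (b j - b' j) - 1.
      under eq_bigr => j _ do rewrite /b'' opprD addrA.
      by rewrite sumrB; congr (_ - _); rewrite (bigD1 i) //= eqxx big1 // => j /negPf ->.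
    have S0 : 0 <= \sum_j (b j - b'' j) by apply: sumr_ge0 => j _; rewrite subr_ge0.
    by move: lt S0; rewrite S; lia.
  rewrite negb_exists => /forallP stuck.
  suff <- : b' = b by [].
  apply: (dominant_unstuck (@matrix_off t) (@mark0_pos t) (@comark0_pos t)
    (matrix_mark tv) (matrix_comark tv) (matrix_sym tv) (matrix_conn tv) level_pos) => //.
  by move=> i lti; have := stuck i; rewrite lti /= -leNgt.
apply: (H _ (fun => 0) _ _ (ltnSn _)) => //.
rewrite /eta_of big1 ?subr0 => [|i _]; last by rewrite mulr0z.
exact: weights_top V_irr.
Qed.

Lemma weyl_dominant b : exists s b', weyl s (eta b) = eta b' /\
  forall i, 0 <= pairing A L b' i.
Proof.
move: b; apply: (dominant_ind (@matrix_diag t) (@matrix_off t) (@mark0_pos t)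
  (@comark0_pos t) (matrix_mark tv) (matrix_sym tv) (matrix_conn tv) L_ge0 level_pos).
  by move=> b dom; exists [::], b.
move=> b i _ [s [b' [E dom]]]; exists (s ++ [:: i]), b'; split=> //.
by rewrite weyl_cat /= reflection_eta.
Qed.

Lemma weyl_mulz_delta s (z : int) : weyl s (delta *~ z) = delta *~ z.
Proof. by rewrite -!scaler_int weylZ weyl_delta. Qed.

Lemma pairing_shift b (z : int) i :
  pairing A L (fun i : I => b i - z * (mark0 t i)%:Z) i = pairing A L b i.
Proof.
rewrite /pairing; congr (_ - _).
under eq_bigr => j _ do rewrite mulrBr mulrCA.
by rewrite sumrB -mulr_sumr matrix_mark // mulr0 subr0.
Qed.

(** The null root is fixed by W and pairs to zero with the coroots, so the shift can be made at a
    dominant conjugate, where nonnegative coordinates suffice. *)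
Lemma weights_sub_delta b (n : nat) s b' : weyl s (eta b) = eta b' ->
    (forall i, 0 <= pairing A L b' i) -> (forall i, 0 <= b' i + n%:Z * (mark0 t i)%:Z) ->
  P (eta b - delta *~ n).
Proof.
move=> E dom pos.
have : P (eta b' + delta *~ (- n%:Z)).
  rewrite eta_add_delta; apply: dominant_weights => i.
    by rewrite mulNr opprK.
  by rewrite pairing_shift.
rewrite -E -(weyl_mulz_delta s) -weylD => /(weights_weyl (rev s)).
by rewrite weyl_revK mulrNz.
Qed.

Lemma weights_down mu (n : nat) : P mu -> P (mu - delta *~ n).
Proof.
move=> Pmu; have [b E b0] := weights_eta Pmu; rewrite E in Pmu *.
have [s [b' [E' dom]]] := weyl_dominant b.
apply: (weights_sub_delta E' dom) => i.
have := weights_weyl s Pmu; rewrite E' => /weights_eta_ge0 /(_ i).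
by move=> b'0; rewrite addr_ge0 // mulr_ge0.
Qed.

Lemma weights_exist b : exists n : nat, P (eta b - delta *~ n).
Proof.
have [s [b' [E dom]]] := weyl_dominant b.
(* All marks are at least one, so this multiple of delta makes every coordinate nonnegative. *)
exists (\sum_i `|b' i|)%N; apply: (weights_sub_delta E dom) => i.
have le : (`|b' i| <= \sum_j `|b' j|)%N by rewrite (bigD1 i) //= leq_addr.
have := @mark0_pos t i; move: le; move: (mark0 t i) (\sum_j _)%N => m n; nia.
Qed.

(** The coordinate of a weight at node 0 is nonnegative, which bounds the shift above; adding [n0]
    turns the search into a maximum over naturals. *)
Lemma delta_shift_exists b : exists s, is_delta_shift P (eta b) s.
Proof.
have [n0 Hn0] := weights_exist b.
pose Q m := `[< P (eta b + delta *~ (m%:Z - n0%:Z)) >].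
have bound z : P (eta b + delta *~ z) -> z <= `|b ord0|%:Z.
  rewrite eta_add_delta => /weights_eta_ge0 /(_ ord0).
  by have := @mark0_pos t ord0; nia.
have exQ : exists m, Q m.
  by exists 0%N; apply/asboolP; rewrite sub0r mulrNz.
have bQ m : Q m -> (m <= `|b ord0| + n0)%N by move=> /asboolP /bound; lia.
case: (ex_maxnP exQ bQ) => m /asboolP Qm mx.
exists (m%:Z - n0%:Z); split=> // s' Ps'.
have [neg|pos] := ltP s' (- n0%:Z); first by lia.
have : Q `|(s' + n0%:Z)%R|%N.
  by apply/asboolP; have -> : `|(s' + n0%:Z)%R|%N%:Z - n0%:Z = s' by lia.
by move/mx; lia.
Qed.

(** * Maximal weights and the delta-shift *)

Notation M := (lattice_M X).
Notation Ntilde := (max_dominant_orbits P).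

Lemma delta_shift_unique mu s s' :
  is_delta_shift P mu s -> is_delta_shift P mu s' -> s = s'.
Proof. by move=> [P1 H1] [P2 H2]; apply/le_anti; rewrite H2 // H1. Qed.

(** Maximality forbids a single step up by delta; closure of the weights under subtracting delta
    extends this to all larger steps. *)
Lemma delta_shift_maximal mu s :
  is_delta_shift P mu s <-> maximal_weights P (mu + delta *~ s).
Proof.
split=> [[Ps H]|[Ps H]].
  split=> // Ps1; have : s + 1 <= s.
    by apply: H; rewrite mulrzDr mulr1z addrA.
  by rewrite gerDl.
split=> // s' Ps'; rewrite leNgt; apply/negP => lt; apply: H.
have := weights_down `|(s' - s - 1)%R|%N Ps'.
rewrite -addrA -mulrzBr.
have -> : s' - `|(s' - s - 1)%R|%N%:Z = s + 1 by lia.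
by rewrite mulrzDr mulr1z addrA.
Qed.

Lemma maximal_shift0 mu : maximal_weights P mu <-> is_delta_shift P mu 0.
Proof. by rewrite delta_shift_maximal mulr0z addr0. Qed.

Lemma maximal_weyl s mu : maximal_weights P mu -> maximal_weights P (weyl s mu).
Proof.
move=> [Pmu H]; split; first exact: weights_weyl.
move=> H'; apply: H; have := weights_weyl (rev s) H'.
by rewrite weylD weyl_revK weyl_delta.
Qed.

Lemma maximal_translation a mu : M a -> maximal_weights P mu ->
  maximal_weights P (translation a mu).
Proof. by move=> /(lattice_tiw tv) [_ [s ->]]; apply: maximal_weyl. Qed.

Lemma finite_weylP (w : weight X -> weight X) : finite_weyl X w <->
  exists s, w = weyl (finite_word s).
Proof.
suff E s : foldr (fun i f => reflection (lift ord0 i) \o f) id s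
    = weyl (finite_word s) :> (weight X -> weight X).
  by split=> [] [s ->]; exists s; rewrite E.
by elim: s => //= i s ->.
Qed.

Lemma orbits_maximal mu : Ntilde mu -> maximal_weights P mu.
Proof. by move=> [w [nu [/finite_weylP [s ->] [H _] ->]]]; apply: maximal_weyl. Qed.

Lemma maximal_class mu : maximal_weights P mu ->
  exists2 a, M a & exists2 nu, Ntilde nu & mu = translation a nu.
Proof.
move=> Mmu; have [b E _] := weights_eta Mmu.1.
have [s [b' [E' dom]]] := weyl_dominant b.
have [a [r [Ma H]]] := weyl_decomposition X tv (rev s).
exists a => //; exists (weyl (finite_word r) (eta b')); last first.
  by rewrite -H -E' weyl_revK.
exists (weyl (finite_word r)), (eta b'); split=> //.
  by apply/finite_weylP; exists r.
split; first by rewrite -E' -E; apply: maximal_weyl.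
move=> i; exists `|pairing A L b' i|%N; rewrite eta_coroot.
by rewrite -[in LHS](gez0_abs (dom i)).
Qed.

Lemma eta_sub b b' : eta b - eta b' = \sum_i al i *~ (b' i - b i).
Proof.
rewrite /eta_of opprB addrC addrA subrK -sumrB.
by apply: eq_bigr => i _; rewrite mulrzBr.
Qed.

(** * Residues and translations *)

Notation a0 := ((mark X ord0)%:R : C).
Notation m_ i := ((mark X i)%:Z).

Definition det_coord (c : I -> int) (i : 'I_(rank t)) : int :=
  m_ ord0 * c (lift ord0 i) - m_ (lift ord0 i) * c ord0.

(** The vector alpha of the theorem, with [c] the coordinates of eta - zeta. *)
Definition residue_root (c : I -> int) : weight X :=
  (k%:R * a0)^-1 *: \sum_(i < rank t) al (lift ord0 i) *~ det_coord c i.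

Lemma same_residuesP b b' : residues X k b = residues X k b' <->
  exists z : 'I_(rank t) -> int,
    forall i, det_coord (fun j => b' j - b j) i = (k * dcoef X i)%N%:Z * z i.
Proof.
have E i : det_coord (fun j => b' j - b j) i = det_coord b' i - det_coord b i.
  by rewrite /det_coord; ring.
split=> [/ffunP H|[z Hz]].
  pose d i := det_coord (fun j => b' j - b j) i.
  have dv i : ((k * dcoef X i)%N%:Z %| d i)%Z.
    by rewrite /d E -eqz_mod_dvd; apply/eqP; have := H i; rewrite !ffunE.
  exists (fun i => (d i %/ (k * dcoef X i)%N%:Z)%Z) => i.
  by rewrite mulrC divzK.
apply/ffunP => i; rewrite !ffunE; apply/esym/eqP.
by rewrite eqz_mod_dvd -/(det_coord b' i) -/(det_coord b i) -E Hz dvdz_mulr.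
Qed.

Lemma root_sum_split (c : I -> int) :
  \sum_i al i *~ c i = k%:R *: residue_root c + ((c ord0)%:~R / a0) *: delta.
Proof.
have k0 : k%:R != 0 :> C by rewrite pnatr_eq0 -lt0n.
have a00 : a0 != 0 := mark_neq0 X tv ord0.
rewrite /residue_root scalerA delta_sum !scaler_sumr.
rewrite big_ord_recl [X in _ = _ + X]big_ord_recl addrCA /=.
rewrite scalerA divfK // scaler_int; congr (_ + _).
rewrite -big_split; apply: eq_bigr => i _ /=.
rewrite -!scaler_int !scalerA -scalerDl /det_coord.
have -> // : (c (lift ord0 i))%:~R = k%:R / (k%:R * a0) *
  (m_ ord0 * c (lift ord0 i) - m_ (lift ord0 i) * c ord0)%:~R
  + (c ord0)%:~R / a0 * (mark X (lift ord0 i))%:R.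
by rewrite intrB !intrM -!pmulrn; field; rewrite k0 a00.
Qed.

Lemma residue_root_lattice c (z : 'I_(rank t) -> int) :
  (forall i, det_coord c i = (k * dcoef X i)%N%:Z * z i) -> M (residue_root c).
Proof.
move=> H; exists z; rewrite /residue_root scaler_sumr; apply: eq_bigr => i _.
rewrite H -!scaler_int !scalerA; have -> // : (k%:R * a0)^-1 * ((k * dcoef X i)%N%:Z * z i)%:~R
   = (z i)%:~R * ((dcoef X i)%:R / a0) :> C.
have k0 : k%:R != 0 :> C by rewrite pnatr_eq0 -lt0n.
by rewrite intrM -!pmulrn natrM; field; rewrite k0 mark_neq0.
Qed.

(** The coefficient of alpha_0 is zero on the left and [x] times a_0 on the right. *)
Lemma finite_roots_delta (f : 'I_(rank t) -> C) (x : C) :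
  \sum_i f i *: al (lift ord0 i) = x *: delta -> x = 0 /\ forall i, f i = 0.
Proof.
move=> E; pose h (i : I) : C :=
  (if unlift ord0 i is Some j then f j else 0) - x * (mark X i)%:R.
have hE : \sum_i h i *: al i = 0.
  under eq_bigr => i _ do rewrite scalerBl -scalerA.
  rewrite sumrB -scaler_sumr -delta_sum -E big_ord_recl unlift_none scale0r add0r.
  by apply/eqP; rewrite subr_eq0; apply/eqP; apply: eq_bigr => i _; rewrite liftK.
have x0 : x = 0.
  have := roots_indep hE ord0; rewrite /h unlift_none sub0r => /eqP.
  by rewrite oppr_eq0 mulf_eq0 (negPf (mark_neq0 X tv ord0)) orbF => /eqP.
split=> // i; have := roots_indep hE (lift ord0 i).
by rewrite /h liftK x0 mul0r subr0.
Qed.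

Lemma lattice_coords a : M a -> exists z : 'I_(rank t) -> int,
  a = \sum_i ((dcoef X i)%:R / a0 * (z i)%:~R) *: al (lift ord0 i).
Proof.
move=> [z ->]; exists z; apply: eq_bigr => i _.
by rewrite -scaler_int scalerA mulrC.
Qed.

(** At a node of mark one, [x] can be read off as a difference of integral coordinates. *)
Lemma delta_multiple b b' (x : C) : eta b - eta b' = x *: delta -> exists r : int, x = r%:~R.
Proof.
rewrite eta_sub delta_sum scaler_sumr => E.
have [p pr mp] := mark0_unit tv.
pose q : I := inord p; exists (b' q - b q).
have : \sum_i ((b' i - b i)%:~R - x * (mark X i)%:R) *: al i = 0.
  under eq_bigr => i _ do rewrite scalerBl -scalerA scaler_int.
  by rewrite sumrB E subrr.
move/roots_indep/(_ q)/eqP; rewrite subr_eq0 => /eqP ->.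
by rewrite markE // inordK // mp mulr1.
Qed.

(** Modulo delta, the difference of the two weights is both [k] times [a] and [k] times a
    [residue_root]; comparing coordinates in the finite simple roots gives the divisibility. *)
Lemma translation_residue b b' a (r : int) : M a ->
    eta b = translation a (eta b') + delta *~ r ->
  residues X k b = residues X k b'.
Proof.
move=> Ma E; apply/same_residuesP.
pose c j := b' j - b j.
have [x Ex] : exists x, eta b - eta b' = k%:R *: a + x *: delta.
  exists (r%:~R - (inv_form (eta b') a + inv_form a a * k%:R / 2)).
  rewrite E /translation level_eta scalerBl scaler_int.
  by apply/eqP; rewrite subr_eq [eqbRHS]addrC !addrA [eqbRHS]addrAC.
move: Ex; rewrite eta_sub root_sum_split => Ex.
have [z zE] := lattice_coords Ma; exists z => i.
have k0 : k%:R != 0 :> C by rewrite pnatr_eq0 -lt0n.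
have a00 : a0 != 0 := mark_neq0 X tv ord0.
(* The coefficient at node i + 1 of k times the difference of [residue_root c] and [a]. *)
pose f i := (det_coord c i)%:~R / a0 - k%:R * ((dcoef X i)%:R / a0 * (z i)%:~R).
have fE : \sum_i f i *: al (lift ord0 i) = (x - (c ord0)%:~R / a0) *: delta.
  transitivity (k%:R *: residue_root c - k%:R *: a).
    rewrite zE /residue_root scalerA !scaler_sumr -sumrB; apply: eq_bigr => j _.
    rewrite -scaler_int !scalerA -scalerBl.
    have -> // : f j = k%:R / (k%:R * a0) * (det_coord c j)%:~R
      - k%:R * ((dcoef X j)%:R / a0 * (z j)%:~R).
    by rewrite /f; field; rewrite k0 a00.
  rewrite scalerBl; apply/eqP; rewrite subr_eq addrAC eq_sym subr_eq addrC; apply/eqP.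
  by rewrite Ex addrC.
have [_ /(_ i)] := finite_roots_delta fE.
move/eqP; rewrite /f subr_eq0 => /eqP /(canRL (divfK a00)) H.
apply/eqP; rewrite -(@eqr_int C) intrM -[_%:Z%:~R]/((k * dcoef X i)%:R) natrM H.
by apply/eqP; field.
Qed.

(** The multiple of delta is at first only an element of the field. A translate of a maximal weight
    is a weight, hence in Lam - Q, and [delta_multiple] then makes the multiple integral. *)
Lemma residue_translation b b' : residues X k b = residues X k b' ->
    maximal_weights P (eta b') ->
  let c := fun j => b' j - b j in
  let a := residue_root c in
  M a /\ exists2 r : int, eta b = translation a (eta b') + delta *~ r &
    r%:~R = (c ord0)%:~R / a0
      + (inv_form (eta b') a + inv_form a a * k%:R / 2).
Proof.
move=> /same_residuesP [z Hz] Mb' c a.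
have Ma : M a := residue_root_lattice Hz.
split=> //.
pose y := inv_form (eta b') a + inv_form a a * k%:R / 2.
have E : eta b = translation a (eta b') + ((c ord0)%:~R / a0 + y) *: delta.
  have /eqP := eta_sub b b'; rewrite -/c root_sum_split subr_eq => /eqP H.
  rewrite /translation level_eta -/y scalerDl H -/a.
  move: (eta b') (k%:R *: a) (_ *: delta) (y *: delta) => u v p q.
  by rewrite [p + q]addrC !addrA subrK [LHS]addrC addrA.
have Pa := (maximal_translation Ma Mb').1.
have [b'' Eb _] := weights_eta Pa.
have [r rE] : exists r : int, (c ord0)%:~R / a0 + y = r%:~R.
  by apply: (@delta_multiple b b''); rewrite E Eb addrC addKr.
by exists r; rewrite -?rE // E rE scaler_int.
Qed.

(** * Class representatives and the determination of alpha *)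

Variable Nbar : set (weight X).
Hypothesis NbarP : is_class_representatives Ntilde Nbar.

Lemma Nbar_maximal zeta : Nbar zeta -> maximal_weights P zeta.
Proof. by move=> /NbarP.1 /orbits_maximal. Qed.

Lemma Nbar_exists b : exists2 zeta, Nbar zeta & same_residues Lam k (eta b) zeta.
Proof.
have [s /delta_shift_maximal Ms] := delta_shift_exists b.
have [a Ma [nu Nnu E]] := maximal_class Ms.
have [zeta [[Nz [_ [a' Ma' <-] zE]] _]] := NbarP.2 nu Nnu.
have [b' bE _] := weights_eta (Nbar_maximal Nz).1.
exists zeta => //; exists b, b'; split=> //.
(* The maximal weight above or below eta is t_a(nu), and zeta = t_a'(nu), so that weight is t_(a -
   a')(zeta). *)
apply: (@translation_residue b b' (a - a') (- s)); first exact/latticeD/latticeN.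
have [la _] := lattice_tiw tv Ma; have [la' _] := lattice_tiw tv Ma'.
have lna : level (a - a') = 0 by rewrite levelD -scaleN1r levelZ la la' mulr0 addr0.
by rewrite -bE zE translD // subrK -E mulrNz addrK.
Qed.

(** Equal residues make zeta' a translate of zeta up to a multiple of delta. Both are maximal, so
    the multiple is zero and the two share a T-class. *)
Lemma Nbar_unique b zeta zeta' : Nbar zeta -> same_residues Lam k (eta b) zeta ->
  Nbar zeta' -> same_residues Lam k (eta b) zeta' -> zeta = zeta'.
Proof.
move=> Nz [b1 [b2 [E1 E2 E3]]] Nz' [b3 [b4 [E4 E5 E6]]].
have b13 : b1 = b3 by apply/funext => i; apply: eta_inj; rewrite -E1 -E4.
have res : residues X k b4 = residues X k b2 by rewrite -E6 -b13 E3.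
have Mz := Nbar_maximal Nz; have Mz' := Nbar_maximal Nz'.
rewrite E2 in Mz; have [Ma [r rE _]] := residue_translation res Mz.
rewrite -E2 -E5 in rE Mz; set a := residue_root _ in Ma rE.
have r0 : - r = 0.
  apply: (@delta_shift_unique zeta'); last exact/maximal_shift0.
  apply/delta_shift_maximal; rewrite mulrNz rE addrK.
  exact: maximal_translation.
have /eqP := r0; rewrite oppr_eq0 => /eqP {}r0.
have [w [_ uniq]] := NbarP.2 zeta (NbarP.1 _ Nz).
rewrite -(uniq zeta); last first.
  split=> //; exists (translation 0); last by rewrite transl0.
  by exists 0 => //; apply: lattice0.
apply: uniq; split=> //; exists (translation a); first by exists a.
by rewrite rE r0 mulr0z addr0.
Qed.

Lemma determined b s zeta : is_delta_shift P (eta b) s -> Nbar zeta ->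
    same_residues Lam k (eta b) zeta ->
  exists2 a, M a /\ eta b = translation a zeta - delta *~ s &
   (forall a', M a' -> eta b = translation a' zeta - delta *~ s -> a' = a) /\
   exists c : I -> int,
     [/\ eta b - zeta = \sum_i al i *~ c i, a = residue_root c
       & s%:~R = - ((c ord0)%:~R / a0)
               - (inv_form zeta a + inv_form a a * k%:R / 2)].
Proof.
move=> Hs Nz [b1 [b2 [E1 E2 E3]]].
have Mz := Nbar_maximal Nz.
have b1E : b1 = b by apply/funext => i; apply/esym/eta_inj.
rewrite b1E E2 in E3 Mz *.
have [Ma [r rE rF]] := residue_translation E3 Mz.
set c := (fun j => b2 j - b j) in Ma rE rF.
have sr : s = - r.
  apply: (delta_shift_unique Hs); apply/delta_shift_maximal.
  by rewrite mulrNz rE addrK; apply: maximal_translation.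
exists (residue_root c).
  by split=> //; rewrite sr mulrNz opprK.
split; last first.
  exists c; split=> //; first by rewrite eta_sub.
  by rewrite sr mulrNz rF opprD.
move=> a' Ma' E'.
(* Two solutions differ by an element of M proportional to delta; having no alpha_0 component, it
   vanishes. *)
have Md : M (a' - residue_root c) by apply/latticeD/latticeN.
have [x Ex] : exists x, k%:R *: (a' - residue_root c) = x *: delta.
  move: E'; rewrite rE sr mulrNz opprK => /addIr; rewrite /translation !level_eta.
  move: (residue_root c) => a.
  pose f d := inv_form (eta b2) d + inv_form d d * k%:R / 2.
  rewrite -/(f a) -/(f a') => H; exists (f a' - f a).
  rewrite scalerBr scalerBl.
  move: H; move: (eta b2) (k%:R *: a) (k%:R *: a') (f a *: delta) (f a' *: delta).
  move=> u v v' p q; rewrite -!addrA => /addrI H.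
  have -> : v' = v - p + q by rewrite H subrK.
  by rewrite addrC !addrA addNr add0r addrC.
have [z zE] := lattice_coords Md.
have fE : \sum_i (k%:R * ((dcoef X i)%:R / a0 * (z i)%:~R)) *: al (lift ord0 i)
    = x *: delta.
  by rewrite -Ex zE scaler_sumr; apply: eq_bigr => i _; rewrite scalerA.
have [x0 _] := finite_roots_delta fE.
move/eqP: Ex; rewrite x0 scale0r scaler_eq0 pnatr_eq0 -leqn0 leqNgt k_gt0 /=.
by rewrite subr_eq0 => /eqP.
Qed.

End Labels.
End WeightSet.

Local Open Scope complex_scope.

Theorem theorem2p7 (R : realType) (t : affine_type) (t_valid : valid_type t)
    (X : affine_datum R[i] t) (g : kac_moody X)
    (Lam : weight X) (Lam_dom : dominant_integral Lam)
    (k : nat) (k_gt0 : (0 < k)%N) (Lam_level : level Lam = k%:R)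
    (V : lie_module g) (V_irr : is_irr_highest_weight V Lam)
    (Nbar : set (weight X))
    (NbarP : is_class_representatives
               (max_dominant_orbits (weights V)) Nbar)
    (b : 'I_(rank t).+1 -> int) :
  let eta := eta_of Lam b in
  let P := weights V in
  (exists! s : int, is_delta_shift P eta s) /\
  (exists! zeta, Nbar zeta /\ same_residues Lam k eta zeta) /\
  forall (s : int) (zeta : weight X),
    is_delta_shift P eta s ->
    Nbar zeta -> same_residues Lam k eta zeta ->
    let determines (alpha : weight X) :=
      lattice_M X alpha /\
      eta = translation alpha zeta - null_root X *~ s in
    (exists! alpha, determines alpha) /\
    forall alpha, determines alpha ->
      (exists c : 'I_(rank t).+1 -> int,
         [/\ eta - zeta = \sum_i simple_root X i *~ c i,
             alpha = (k%:R * (mark X ord0)%:R)^-1 *: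
               \sum_(i < rank t) simple_root X (lift ord0 i) *~
                 ((mark X ord0)%:Z * c (lift ord0 i)
                  - (mark X (lift ord0 i))%:Z * c ord0)
           & s%:~R = - ((c ord0)%:~R / (mark X ord0)%:R)
               - (inv_form zeta alpha + inv_form alpha alpha * k%:R / 2)]) /\
      (P eta <-> 0 <= s).
Proof.
move=> eta P.
have [L [L_ge0 LamL L_level]] := labels_exist t_valid Lam_dom Lam_level.
split.
  have [s Hs] := delta_shift_exists t_valid Lam_dom k_gt0 V_irr L_ge0 LamL L_level b.
  by exists s; split=> // s'; apply: delta_shift_unique Hs.
split.
  have [zeta Nz Sz] := Nbar_exists t_valid Lam_dom k_gt0 Lam_level V_irr L_ge0 LamL
    L_level NbarP b.
  exists zeta; split=> // zeta' [Nz' Sz'].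
  exact: (Nbar_unique t_valid Lam_dom k_gt0 Lam_level V_irr L_ge0 LamL
    L_level NbarP Nz Sz Nz' Sz').
move=> s zeta Hs Nz Sz determines.
have [a [Ma E] [uniq F]] := determined t_valid Lam_dom k_gt0 Lam_level V_irr L_ge0 LamL
    L_level NbarP Hs Nz Sz.
split; first by exists a; split=> // a' [Ma' E']; apply/esym/uniq.
move=> alpha [Ma' E']; split; first by rewrite (uniq _ Ma' E').
split=> [Pe|s0]; first by apply: Hs.2; rewrite mulr0z addr0.
(* Since eta + s delta is a weight, going down by delta [s] times reaches eta. *)
have := weights_down t_valid Lam_dom k_gt0 V_irr L_ge0 LamL L_level `|s|%N Hs.1.
by rewrite gez0_abs // addrK.
Qed.
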